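(* Let $P$ be a finite poset, regarded as a category with a unique arrow $p\to q$ whenever $p\le q$. Let $K:P\to\mathcal{S}$ be a diagram of topological spaces and let $X:P\to\mathcal{P}_{<\infty}$ be a diagram of finite posets, where each $X_p$ is viewed as a finite topological space. Let $\phi:K\to X$ be a morphism of diagrams (a family of continuous maps $\phi_p:K_p\to X_p$ commuting with the transition maps) such that $\phi_p$ is a weak homotopy equivalence for every $p\in P$. Then there exists a weak homotopy equivalence $$\hat\phi:\operatorname{hocolim} K\to \operatorname{\underline{hocolim}} X.$$
   Context: $\mathcal{S}$ is the category of topological spaces and $\mathcal{P}_{<\infty}$ the category of finite posets and order-preserving maps. A finite poset is viewed as a finite topological space whose open sets are the down-sets; order-preserving maps are exactly the continuous maps. A weak homotopy equivalence is a continuous map inducing isomorphisms on all homotopy groups (for all base points). For a diagram $X$ write $X_p=X(p)$ and $g_{pq}=X(p\to q)$ for $p\le q$. The non-Hausdorff homotopy colimit $\operatorname{\underline{hocolim}} X$ is the finite poset (= finite space) with underlying set $\coprod_{p\in P}X_p$, keeping the order inside each $X_p$, and for $x\in X_p$, $y\in X_q$ with $p\le q$ setting $x\le y$ iff $g_{pq}(x)\le y$ in $X_q$ (the Grothendieck construction). $\operatorname{hocolim} K$ denotes the usual (Bousfield–Kan) homotopy colimit in $\mathcal{S}$, which can be constructed as $\coprod_{p\in P}K_p\times\mathcal{K}(F_p)$ modulo the relation identifying $(\alpha,\beta)\in K_p\times \mathcal{K}(F_p)$ with $(K(p\to p')(\alpha),\beta)\in K_{p'}\times\mathcal{K}(F_{p'})$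 when $\beta\in\mathcal{K}(F_{p'})$, $p\le p'$; here $F_p=\{r\in P: r\ge p\}$ and $\mathcal{K}(Q)$ is the order complex of a poset $Q$ (the simplicial complex of nonempty chains). *)

(* Defs.v *)
From HB Require Import structures.
From mathcomp Require Import all_boot all_order all_algebra.
From mathcomp Require Import all_classical all_reals all_analysis.
From mathcomp Require Import generic_quotient.
From Stdlib Require Import Relation_Operators.

Set Implicit Arguments.
Unset Strict Implicit.
Unset Printing Implicit Defensive.

Import Order.TTheory GRing.Theory Num.Theory.
Import numFieldTopology.Exports.
Local Open Scope classical_set_scope.
Local Open Scope quotient_scope.

Definition downtop (T : choiceType) (le : rel T) : Type := T.

HB.instance Definition _ (T : choiceType) (le : rel T) :=
  Choice.on (downtop le).

Definition down_open (T : choiceType) (le : rel T) (A : set (downtop le)) :=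
  forall x y : T, le y x -> A x -> A y.

Lemma down_openT (T : choiceType) (le : rel T) : down_open (@setT (downtop le)).
Proof. by []. Qed.

Lemma down_openI (T : choiceType) (le : rel T) : setI_closed (@down_open T le).
Proof. by move=> A B oA oB x y yx [Ax Bx]; split; [exact: oA yx Ax|exact: oB yx Bx]. Qed.

Lemma down_open_bigU (T : choiceType) (le : rel T) (I : Type)
  (f : I -> set (downtop le)) : (forall i, down_open (f i)) ->
  down_open (\bigcup_i f i).
Proof. by move=> oF x y yx [i _ fxi]; exists i => //; exact: oF yx fxi. Qed.

HB.instance Definition _ (T : choiceType) (le : rel T) :=
  isOpenTopological.Build (downtop le) (@down_openT T le) (@down_openI T le)
    (@down_open_bigU T le).

Definition finspace (d : Order.disp_t) (Q : finPOrderType d) : topologicalType :=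
  downtop (<=%O : rel Q).

Local Open Scope ring_scope.

Definition unit_int (R : realType) : set R := [set r | 0 <= r <= 1].

Definition cube (R : realType) (n : nat) : topologicalType :=
  {ptws 'I_n -> set_type (@unit_int R)}.

Definition cube_bdry (R : realType) (n : nat) (c : cube R n) : Prop :=
  exists i : 'I_n, val (c i) = 0 \/ val (c i) = 1.

(* Representatives of elements of pi_n(T, x): continuous maps
   (I^n, boundary) -> (T, x). For n = 0 this is just a point of T. *)
Definition based_cube_map (R : realType) (T : topologicalType) (n : nat)
  (x : T) (f : cube R n -> T) : Prop :=
  continuous f /\ (forall c, cube_bdry c -> f c = x).

(* Homotopy relative to the boundary of the cube (for n = 0 this is
   the relation "joined by a path"). *)
Definition homotopic_rel_bdry (R : realType) (T : topologicalType) (n : nat)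
  (x : T) (f g : cube R n -> T) : Prop :=
  exists H : (set_type (@unit_int R) * cube R n)%type -> T,
    [/\ continuous H,
        (forall t c, val t = 0 -> H (t, c) = f c),
        (forall t c, val t = 1 -> H (t, c) = g c) &
        (forall t c, cube_bdry c -> H (t, c) = x)].

(* f : T -> U is a weak homotopy equivalence: f is continuous, and for
   every base point x and every n the induced map
   pi_n(T, x) -> pi_n(U, f x), [h] |-> [f o h], is a bijection (surjective
   and injective on homotopy classes); moreover pi_0(T) -> pi_0(U) is
   surjective (which covers the case of an empty T). *)
Definition weak_homotopy_equivalence (R : realType) (T U : topologicalType)
  (f : T -> U) : Prop :=
  [/\ continuous f,
      (forall y : U, exists x : T,
          @homotopic_rel_bdry R U 0 y (fun=> f x) (fun=> y)) &
      (forall (n : nat) (x : T),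
        (forall g : cube R n -> U, based_cube_map (f x) g ->
           exists h : cube R n -> T, based_cube_map x h /\
             homotopic_rel_bdry (f x) (f \o h) g) /\
        (forall h1 h2 : cube R n -> T, based_cube_map x h1 ->
           based_cube_map x h2 ->
           homotopic_rel_bdry (f x) (f \o h1) (f \o h2) ->
           homotopic_rel_bdry x h1 h2))].

Record top_diagram (d : Order.disp_t) (P : porderType d) := TopDiagram {
  tobj : P -> topologicalType;
  tmap : forall p q : P, (p <= q)%O -> tobj p -> tobj q;
  tmap_cont : forall p q (h : (p <= q)%O), continuous (tmap h);
  tmap_id : forall p (h : (p <= p)%O) x, tmap h x = x;
  tmap_comp : forall p q r (h1 : (p <= q)%O) (h2 : (q <= r)%O)
    (h3 : (p <= r)%O) x, tmap h2 (tmap h1 x) = tmap h3 x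
}.

Record poset_diagram (d : Order.disp_t) (P : porderType d) (dX : Order.disp_t)
  := PosetDiagram {
  pobj : P -> finPOrderType dX;
  pmap : forall p q : P, (p <= q)%O -> pobj p -> pobj q;
  pmap_mono : forall p q (h : (p <= q)%O), {homo pmap h : x y / (x <= y)%O};
  pmap_id : forall p (h : (p <= p)%O) x, pmap h x = x;
  pmap_comp : forall p q r (h1 : (p <= q)%O) (h2 : (q <= r)%O)
    (h3 : (p <= r)%O) x, pmap h2 (pmap h1 x) = pmap h3 x
}.

Arguments tobj {d P} t p : rename.
Arguments tmap {d P} t {p q} _ _ : rename.
Arguments pobj {d P dX} p _ : rename.
Arguments pmap {d P dX} p {p0 q} _ _ : rename.

Record diagram_morphism (d : Order.disp_t) (P : porderType d)
  (dX : Order.disp_t) (K : top_diagram P) (X : poset_diagram P dX) :=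
  DiagramMorphism {
  dmor : forall p : P, tobj K p -> finspace (pobj X p);
  dmor_cont : forall r : P, continuous (@dmor r);
  dmor_nat : forall p q (h : (p <= q)%O) (x : tobj K p),
    @dmor q (@tmap _ _ K p q h x) = @pmap _ _ _ X p q h (@dmor p x)
}.

(* Geometric realization of order complexes.                          *)
(* |K(Q)| for Q a subset of the finite poset P: barycentric coordinates *)
(* t : P -> R supported on a chain contained in Q, with the subspace   *)
(* topology of R^P (for a finite complex this is the usual topology).  *)

Definition order_complex_point (R : realType) (d : Order.disp_t)
  (P : finPOrderType d) (Q : set P) (t : P -> R) : Prop :=
  [/\ (forall r, 0 <= t r),
      \sum_(r : P) t r = 1,
      (forall r, t r != 0 -> Q r) &
      (forall r s, t r != 0 -> t s != 0 -> (r <= s)%O || (s <= r)%O)].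

Definition upset (d : Order.disp_t) (P : porderType d) (p : P) : set P :=
  [set r | (p <= r)%O].

Definition realization_F (R : realType) (d : Order.disp_t)
  (P : finPOrderType d) (p : P) : topologicalType :=
  set_type [set t : {ptws P -> R} | order_complex_point (upset p) t].

Definition hocolim_pre (R : realType) (d : Order.disp_t) (P : finPOrderType d)
  (K : top_diagram P) : topologicalType :=
  {p : P & (tobj K p * realization_F R p)%type}.

Definition hocolim_step (R : realType) (d : Order.disp_t) (P : finPOrderType d)
  (K : top_diagram P) (u v : hocolim_pre R K) : Prop :=
  exists h : (tag u <= tag v)%O,
    tmap K h (tagged u).1 = (tagged v).1 /\
    (val (tagged u).2 : P -> R) = val (tagged v).2.

Definition hocolim_rel (R : realType) (d : Order.disp_t) (P : finPOrderType d)
  (K : top_diagram P) : rel (hocolim_pre R K) :=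
  fun u v => `[< clos_refl_sym_trans _ (@hocolim_step R d P K) u v >].

Lemma hocolim_rel_refl R d P K : reflexive (@hocolim_rel R d P K).
Proof. by move=> u; apply/asboolP; apply: rst_refl. Qed.

Lemma hocolim_rel_sym R d P K : symmetric (@hocolim_rel R d P K).
Proof.
move=> u v; apply/asboolP/asboolP; exact: rst_sym.
Qed.

Lemma hocolim_rel_trans R d P K : transitive (@hocolim_rel R d P K).
Proof.
move=> v u w /asboolP H1 /asboolP H2; apply/asboolP; exact: rst_trans H1 H2.
Qed.

Definition hocolim_equiv R d P K : equiv_rel (hocolim_pre R K) :=
  @EquivRelPack _ (@hocolim_rel R d P K)
    (EquivClass (@hocolim_rel_refl R d P K)
       (@hocolim_rel_sym R d P K) (@hocolim_rel_trans R d P K)).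

Definition hocolim (R : realType) (d : Order.disp_t) (P : finPOrderType d)
  (K : top_diagram P) : topologicalType :=
  quotient_topology {eq_quot (hocolim_equiv R K)}.

Definition groth_carrier (d : Order.disp_t) (P : finPOrderType d)
  (dX : Order.disp_t) (X : poset_diagram P dX) : choiceType :=
  {p : P & pobj X p}.

Definition groth_le (d : Order.disp_t) (P : finPOrderType d)
  (dX : Order.disp_t) (X : poset_diagram P dX) : rel (groth_carrier X) :=
  fun u v =>
    (if (tag u <= tag v)%O as b return ((tag u <= tag v)%O = b -> bool)
     then fun h => (pmap X h (tagged u) <= tagged v)%O
     else fun _ => false) erefl.

Definition nh_hocolim (d : Order.disp_t) (P : finPOrderType d)
  (dX : Order.disp_t) (X : poset_diagram P dX) : topologicalType :=
  downtop (@groth_le d P dX X).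

Arguments dmor {d P dX K X} d0 p _ : rename.

(* Main.v *)
Require Import Defs.
From HB Require Import structures.
From mathcomp Require Import all_boot all_order all_algebra.
From mathcomp Require Import all_classical all_reals all_analysis.
From mathcomp Require Import generic_quotient lra zify.
From Stdlib Require Import Relation_Operators.

(** The comparison map sends the class of [(alpha, beta)] in [K_q * |F_q|] to
    [phi_m (K_(q m) alpha)] in [X_m], where [m] is the least vertex of the carrier
    of [beta].  The Grothendieck construction is covered by its open subposets
    lying over the sets [{r <= p}].  Over such a subset the source retracts by
    deformation onto [K_p] (push [beta] to the vertex [p]) and the target onto
    [X_p], so the comparison map is there a weak equivalence because [phi_p] is
    one.  Weak equivalences are glued along open unions by induction on down-sets
    of [P]: they are characterised by the relative lifting property for
    [(D^n, S^(n-1))], and over [V1] or [V2] such problems are solved cell by cell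
    on a grid of the cube so fine that each cell is mapped into [V1] or [V2]. *)

Set Implicit Arguments.
Unset Strict Implicit.
Unset Printing Implicit Defensive.

Import Order.TTheory GRing.Theory Num.Theory.
Import numFieldNormedType.Exports.
Local Open Scope classical_set_scope.
Local Open Scope ring_scope.

(** * Continuity on a subset *)

(** A lifting problem over an open [V] keeps the whole map [f] and only asks that [b] and the final
    homotopy stay in [V]. The restriction of [f] to the preimage of [V] never has to be formed,
    because [f (a x) = b x] already puts the boundary datum there. In the same spirit maps are total
    functions, controlled by [cont_on] on the set that matters and arbitrary elsewhere. Homotopy
    groups yield homotopies that are fixed on the sphere, but a cell solved earlier leaves a moving
    homotopy on the boundary of the next one; this is why the stronger [help_pair] is needed before
    cells can be handled one by one. Cells that lie over both [V1] and [V2] must be solved inside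
    the intersection, so gluing consumes three lifting properties. The induction therefore runs over
    all down-sets of [P]: the part of a down-set below [p] is again a down-set, though in general
    not one of the form of all elements below a vertex. *)

Definition cont_on (T U : topologicalType) (A : set T) (f : T -> U) :=
  forall x, A x -> f @ within A (nbhs x) --> f x.

Section ContOn.
Context {T U : topologicalType}.
Implicit Types (A B : set T) (f g : T -> U).

Lemma cont_onP A f : cont_on A f <->
  (forall x, A x -> forall O, nbhs (f x) O -> \forall y \near x, A y -> O (f y)).
Proof. by split=> fc x Ax O fxO; exact: fc. Qed.

Lemma cont_on_sub A B f : A `<=` B -> cont_on B f -> cont_on A f.
Proof.
move=> AB /cont_onP fB; apply/cont_onP => x Ax O xO.
by have := fB x (AB _ Ax) O xO; apply: filterS => y fy Ay; exact/fy/AB.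
Qed.

Lemma continuous_cont_on A f : continuous f -> cont_on A f.
Proof. by move=> fc x _; apply: cvg_within_filter; exact: fc. Qed.

Lemma cont_on_continuous f : cont_on setT f -> continuous f.
Proof.
move=> /cont_onP fc x O xO; have := fc x I O xO.
by apply: filterS => y; exact.
Qed.

Lemma cont_on_eq A f g : (forall x, A x -> f x = g x) ->
  cont_on A f -> cont_on A g.
Proof.
move=> fg /cont_onP fc; apply/cont_onP => x Ax O; rewrite -fg// => xO.
by have := fc x Ax O xO; apply: filterS => y fy Ay; rewrite -fg//; exact: fy.
Qed.

Lemma cont_on_glue A B f : closed A -> closed B ->
  cont_on A f -> cont_on B f -> cont_on (A `|` B) f.
Proof.
move=> cA cB /cont_onP fA /cont_onP fB; apply/cont_onP => x ABx O xO.
have H (C : set T) : closed C ->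
    (forall x, C x -> forall O, nbhs (f x) O -> \forall y \near x, C y -> O (f y)) ->
    \forall y \near x, C y -> O (f y).
  move=> cC fC; have [Cx|nCx] := pselect (C x); first exact: fC.
  have : nbhs x (~` C) by apply: open_nbhs_nbhs; split=> //; exact: closed_openC.
  by apply: filterS.
apply: filterS2 (H A cA fA) (H B cB fB) => y yA yB [Ay|By].
  exact: yA.
exact: yB.
Qed.

End ContOn.

Lemma cont_on_comp (T U W : topologicalType) (A : set T) (B : set U)
    (f : T -> U) (g : U -> W) :
  cont_on B g -> cont_on A f -> (forall x, A x -> B (f x)) ->
  cont_on A (fun x => g (f x)).
Proof.
move=> /cont_onP gB /cont_onP fA AB; apply/cont_onP => x Ax O xO.
have := fA x Ax _ (gB (f x) (AB _ Ax) O xO).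
by apply: filterS => y fy Ay; apply: fy => //; exact: AB.
Qed.

Lemma cont_on_compT (T U W : topologicalType) (A : set T)
    (f : T -> U) (g : U -> W) :
  continuous g -> cont_on A f -> cont_on A (fun x => g (f x)).
Proof.
by move=> gc fc; apply: (@cont_on_comp _ _ _ _ setT) => //; exact: continuous_cont_on.
Qed.

Lemma cont_on_pair (T U W : topologicalType) (A : set T) (f : T -> U) (g : T -> W) :
  cont_on A f -> cont_on A g -> cont_on A (fun x => (f x, g x)).
Proof. by move=> fc gc x Ax; apply: cvg_pair; [exact: fc|exact: gc]. Qed.

Lemma cont_on_cst (T U : topologicalType) (A : set T) (u : U) :
  cont_on A (fun=> u).
Proof. by apply: continuous_cont_on => x; exact: cvg_cst. Qed.

Lemma cont_on_id (T : topologicalType) (A : set T) : cont_on A id.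
Proof. by apply: continuous_cont_on => x; exact: cvg_id. Qed.

Lemma cont_on_fst (T U : topologicalType) (A : set (T * U)) : cont_on A fst.
Proof. by apply: continuous_cont_on => x; exact: cvg_fst. Qed.

Lemma cont_on_snd (T U : topologicalType) (A : set (T * U)) : cont_on A snd.
Proof. by apply: continuous_cont_on => x; exact: cvg_snd. Qed.

Section ContOnAlg.
Context {R : realType} {T : topologicalType} {V : normedModType R}.
Implicit Types (A : set T) (f g : T -> V) (p q : T -> R).

Lemma cont_onD A f g : cont_on A f -> cont_on A g -> cont_on A (fun x => f x + g x).
Proof. by move=> fc gc x Ax; apply: cvgD; [exact: fc|exact: gc]. Qed.

Lemma cont_onN A f : cont_on A f -> cont_on A (fun x => - f x).
Proof. by move=> fc x Ax; apply: cvgN; exact: fc. Qed.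

Lemma cont_onM A p q : cont_on A p -> cont_on A q -> cont_on A (fun x => p x * q x).
Proof. by move=> fc gc x Ax; apply: cvgM; [exact: fc|exact: gc]. Qed.

Lemma cont_onZ A p f : cont_on A p -> cont_on A f -> cont_on A (fun x => p x *: f x).
Proof. by move=> fc gc x Ax; apply: cvgZ; [exact: fc|exact: gc]. Qed.

Lemma cont_on_norm A f : cont_on A f -> cont_on A (fun x => `|f x|).
Proof. by move=> fc x Ax; apply: cvg_norm; exact: fc. Qed.

Lemma cont_onV A p : (forall x, A x -> p x != 0) -> cont_on A p ->
  cont_on A (fun x => (p x)^-1).
Proof. by move=> p0 pc x Ax; apply: cvgV; [exact: p0|exact: pc]. Qed.

Lemma cont_on_max A p q : cont_on A p -> cont_on A q ->
  cont_on A (fun x => Num.max (p x) (q x)).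
Proof.
move=> pc qc; apply: (@cont_on_eq _ _ _ (fun x => 2^-1 * (p x + q x + `|p x - q x|))).
  move=> x _; case: (leP (p x) (q x)) => pq.
    by rewrite ler0_norm ?subr_le0//; lra.
  by rewrite gtr0_norm ?subr_gt0//; lra.
move=> x Ax; apply: cvgM; first exact: cvg_cst.
apply: cvgD; first by apply: cvgD; [exact: pc|exact: qc].
by apply: cvg_norm; apply: cvgB; [exact: pc|exact: qc].
Qed.

Lemma cont_on_min A p q : cont_on A p -> cont_on A q ->
  cont_on A (fun x => Num.min (p x) (q x)).
Proof.
move=> pc qc; apply: (@cont_on_eq _ _ _ (fun x => 2^-1 * (p x + q x - `|p x - q x|))).
  move=> x _; case: (leP (p x) (q x)) => pq.
    by rewrite ler0_norm ?subr_le0//; lra.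
  by rewrite gtr0_norm ?subr_gt0//; lra.
move=> x Ax; apply: cvgM; first exact: cvg_cst.
apply: cvgB; first by apply: cvgD; [exact: pc|exact: qc].
by apply: cvg_norm; apply: cvgB; [exact: pc|exact: qc].
Qed.

End ContOnAlg.

(** Off the locus [p x = q x] a strict inequality persists nearby and selects one branch; on that
    locus both branches have the same value, so both continuity statements apply at once. *)
Lemma cont_on_if (R : realType) (T U : topologicalType) (A : set T)
    (p q : T -> R) (f g : T -> U) :
  cont_on A p -> cont_on A q ->
  cont_on (A `&` [set x | p x <= q x]) f ->
  cont_on (A `&` [set x | q x <= p x]) g ->
  (forall x, A x -> p x = q x -> f x = g x) ->
  cont_on A (fun x => if p x <= q x then f x else g x).
Proof.
move=> pc qc /cont_onP fc /cont_onP gc fg.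
have lt_near (p1 q1 : T -> R) x : cont_on A p1 -> cont_on A q1 -> A x ->
    p1 x < q1 x -> \forall y \near x, A y -> p1 y < q1 y.
  move=> p1c q1c Ax pq.
  have /cont_onP := cont_onD q1c (cont_onN p1c).
  have qp0 : 0 < q1 x - p1 x by rewrite subr_gt0.
  move=> /(_ x Ax _ (lt_nbhsr qp0)); apply: filterS => y h Ay.
  by rewrite -subr_gt0; exact: h.
apply/cont_onP => x Ax O; case: (ltgtP (p x) (q x)) => pq xO.
- apply: filterS2 (lt_near p q x pc qc Ax pq) (fc x (conj Ax (ltW pq)) O xO).
  by move=> y ypq fy Ay; rewrite (ltW (ypq Ay)); apply: fy; split=> //; exact/ltW/ypq.
- apply: filterS2 (lt_near q p x qc pc Ax pq) (gc x (conj Ax (ltW pq)) O xO).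
  move=> y yqp gy Ay; rewrite leNgt yqp //=; apply: gy; split=> //; exact/ltW/yqp.
- have gO : nbhs (g x) O by rewrite -fg.
  have Ap : (A `&` [set x | p x <= q x]) x by split=> //=; rewrite pq.
  have Aq : (A `&` [set x | q x <= p x]) x by split=> //=; rewrite pq.
  apply: filterS2 (fc x Ap O xO) (gc x Aq O gO) => y fy gy Ay.
  by case: (leP (p y) (q y)) => ypq; [apply: fy|apply: gy; split=> //; exact: ltW].
Qed.

(** Recursion on the shape of the function. What [cont] leaves open are the nonvanishing conditions
    of inverses and the continuity of functions of no listed shape. *)
Ltac cont1 := idtac;
  lazymatch goal with
  | |- cont_on _ (fun=> ?c) => exact: cont_on_cst
  | |- cont_on _ (fun x => x) => exact: cont_on_id
  | |- cont_on _ fst => exact: cont_on_fst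
  | |- cont_on _ snd => exact: cont_on_snd
  | |- cont_on _ (fun x => pair (@?f x) (@?g x)) =>
      refine (@cont_on_pair _ _ _ _ f g _ _)
  | |- cont_on _ (fun x => GRing.add (@?f x) (@?g x)) =>
      refine (@cont_onD _ _ _ _ f g _ _)
  | |- cont_on _ (fun x => GRing.opp (@?f x)) =>
      refine (@cont_onN _ _ _ _ f _)
  | |- cont_on _ (fun x => GRing.mul (@?f x) (@?g x)) =>
      refine (@cont_onM _ _ _ f g _ _)
  | |- cont_on _ (fun x => GRing.scale (@?f x) (@?g x)) =>
      refine (@cont_onZ _ _ _ _ f g _ _)
  | |- cont_on _ (fun x => GRing.inv (@?f x)) =>
      refine (@cont_onV _ _ _ f _ _)
  | |- cont_on _ (fun x => Num.norm (@?f x)) =>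
      refine (@cont_on_norm _ _ _ _ f _)
  | |- cont_on _ (fun x => Order.max (@?f x) (@?g x)) =>
      refine (@cont_on_max _ _ _ f g _ _)
  | |- cont_on _ (fun x => Order.min (@?f x) (@?g x)) =>
      refine (@cont_on_min _ _ _ f g _ _)
  | |- cont_on _ (fun x => fst x) => exact: cont_on_fst
  | |- cont_on _ (fun x => snd x) => exact: cont_on_snd
  | |- cont_on _ (fun x => fst (@?f x)) =>
      refine (@cont_on_comp _ _ _ _ setT f fst (@cont_on_fst _ _ _) _ (fun _ _ => I))
  | |- cont_on _ (fun x => snd (@?f x)) =>
      refine (@cont_on_comp _ _ _ _ setT f snd (@cont_on_snd _ _ _) _ (fun _ _ => I))
  | |- cont_on _ (fun x => @?f x) =>
      first [assumption | exact: cont_on_id | exact: cont_on_snd]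
  | |- cont_on ?A ?f => first [assumption | change (cont_on A (fun x => f x)); cont1]
  end.

Ltac cont := repeat cont1.

(** * Relative lifting problems on the disc *)

Section Disc.
Context {R : realType}.

Definition I01 : set R := [set t | 0 <= t <= 1].
(** The norm on rows is the sup norm: the disc is the cube [[-1, 1]^n] and the sphere its boundary,
    which makes both the based cubes of homotopy groups and the cells of a grid into discs. For
    [n = 0] the disc is a point and the sphere is empty. *)
Definition disc n : set 'rV[R]_n := [set x | `|x| <= 1].
Definition sphere n : set 'rV[R]_n := [set x | `|x| = 1].

Definition hat n (x : 'rV[R]_n) := `|x|^-1 *: x.

Lemma sphere_disc n (x : 'rV[R]_n) : sphere x -> disc x.
Proof. by rewrite /sphere /disc /= => ->. Qed.

Lemma hat_sphere n (x : 'rV[R]_n) : 0 < `|x| -> sphere (hat x).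
Proof.
by move=> x0; rewrite /sphere /hat /= normrZ normfV normr_id mulVf ?gt_eqF.
Qed.

Lemma hat_id n (x : 'rV[R]_n) : sphere x -> hat x = x.
Proof. by rewrite /sphere /hat /= => ->; rewrite invr1 scale1r. Qed.

Lemma hatZ n (c : R) (x : 'rV[R]_n) : 0 < c -> hat (c *: x) = hat x.
Proof.
move=> c0; rewrite /hat normrZ gtr0_norm// scalerA invfM mulrAC mulVf ?gt_eqF//.
by rewrite mul1r.
Qed.

Lemma norm_gtr n (c : R) (x : 'rV[R]_n) : 0 < c -> `|c *: x| = c * `|x|.
Proof. by move=> c0; rewrite normrZ gtr0_norm. Qed.

Lemma cont_on_hat (T : topologicalType) (A : set T) n (f : T -> 'rV[R]_n) :
  (forall x, A x -> 0 < `|f x|) -> cont_on A f -> cont_on A (fun x => hat (f x)).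
Proof.
by rewrite /hat => f0 fc; cont => x Ax; rewrite gt_eqF ?f0.
Qed.

End Disc.

Ltac dlra := cbv beta delta [disc sphere I01 mkset] in *; lra.

Section Lifting.
Context {R : realType}.

Section Problem.
Context {T U : topologicalType} (n : nat) (f : T -> U) (V : set U).
Implicit Types (a : 'rV[R]_n -> T) (b g h : 'rV[R]_n -> U).

Definition lift_problem a b :=
  [/\ cont_on (@sphere R n) a, cont_on (@disc R n) b,
      (forall x, disc x -> V (b x)) &
      (forall x, sphere x -> f (a x) = b x)].

(** The homotopy is stationary on the sphere and stays inside [V] throughout. *)
Definition rel_homotopic g h := exists H : R * 'rV[R]_n -> U,
  [/\ cont_on (I01 `*` @disc R n) H,
      (forall x, disc x -> H (0, x) = g x),
      (forall x, disc x -> H (1, x) = h x),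
      (forall t x, I01 t -> sphere x -> H (t, x) = h x) &
      (forall t x, I01 t -> disc x -> V (H (t, x)))].

Definition lift_solution a b := exists a',
  [/\ cont_on (@disc R n) a', (forall x, sphere x -> a' x = a x) &
      rel_homotopic (f \o a') b].

Lemma rel_homotopic_trans g h k :
  rel_homotopic g h -> rel_homotopic h k -> rel_homotopic g k.
Proof.
move=> [H1 [c1 s1 e1 r1 v1]] [H2 [c2 s2 e2 r2 v2]].
exists (fun z => if z.1 <= 2^-1 then H1 (2 * z.1, z.2) else H2 (2 * z.1 - 1, z.2)).
split=> [||||t x].
- apply: cont_on_if; cont.
  + apply: cont_on_comp c1 _ _; first by cont.
    by move=> [t x] /= [[/andP[? ?] ?] ?]; split => //=; apply/andP; split; dlra.
  + apply: cont_on_comp c2 _ _; first by cont.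
    by move=> [t x] /= [[/andP[? ?] ?] ?]; split => //=; apply/andP; split; dlra.
  + move=> [t x] /= [_ dx] ->; rewrite divff// subrr e1 ?s2//.
- by move=> x dx /=; rewrite ifT ?mulr0 ?s1// invr_ge0.
- move=> x dx /=; rewrite ifF ?mulr1; last by apply/negbTE; rewrite -ltNge; dlra.
  by rewrite (_ : 2 - 1 = 1 :> R) ?e2//; dlra.
- move=> t x /andP[? ?] sx /=; case: ifPn => [?|]; last rewrite -ltNge => ?.
    rewrite r1 //; last by apply/andP; split; dlra.
    by rewrite -s2 ?r2 //; [apply/andP; split; dlra|exact: sphere_disc].
  by rewrite r2 //; apply/andP; split; dlra.
- move=> /andP[? ?] dx /=; case: ifPn => [?|]; last rewrite -ltNge => ?.
    by apply: v1 => //; apply/andP; split; dlra.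
  by apply: v2 => //; apply/andP; split; dlra.
Qed.

End Problem.

(* A solution for [(A_1, b1)] is turned into one for [(A_0, b)] by gluing the
   track of the homotopy [A] onto a collar of the disc, once outwards and
   once inwards; the two tracks then cancel. *)
Lemma lift_deform_aux (T U : topologicalType) n (f : T -> U) (V : set U)
    (A : R * 'rV[R]_n -> T) (b : 'rV[R]_n -> U) :
  continuous f -> cont_on (I01 `*` @sphere R n) A ->
  (forall t x, I01 t -> sphere x -> V (f (A (t, x)))) ->
  lift_problem f V (fun x => A (0, x)) b ->
  (forall b1, lift_problem f V (fun x => A (1, x)) b1 ->
     lift_solution f V (fun x => A (1, x)) b1) ->
  lift_solution f V (fun x => A (0, x)) b.
Proof.
move=> fc Ac AV [_ bc bV fab] sol.
have fAc : cont_on (I01 `*` @sphere R n) (fun z => f (A z)) by exact: cont_on_compT.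
(* [b] is shrunk to radius 1/2 and the collar carries the track of [A] from time 0 to time 1. *)
pose b1 (x : 'rV[R]_n) := if `|x| <= 2^-1 then b (2 *: x) else f (A (2 * `|x| - 1, hat x)).
have b1c : cont_on (@disc R n) b1.
  apply: cont_on_if; cont.
  - apply: (cont_on_comp bc); first by cont.
    by move=> x [_ /= ?]; rewrite /disc /= norm_gtr//; dlra.
  - apply: (cont_on_comp fAc).
      by cont; apply: cont_on_hat => [x [_ /= ?]|]; [dlra|cont].
    move=> x [/= ? ?]; split; first by apply/andP; split => /=; dlra.
    by apply: hat_sphere; dlra.
  - move=> x dx x2; rewrite x2 divff// subrr fab; last by apply: hat_sphere; rewrite x2.
    by rewrite /hat x2 invrK.
have b1V x : disc x -> V (b1 x).
  rewrite /disc /b1 /= => dx; case: ifPn => [?|]; last rewrite -ltNge => ?.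
    by apply: bV; rewrite /disc /= norm_gtr//; dlra.
  by apply: AV; [apply/andP; split; dlra|apply: hat_sphere; dlra].
have [|a1 [a1c a1s [G [Gc G0 G1 Gs GV]]]] := sol b1.
  split=> //.
  - apply: (cont_on_comp Ac); first by cont.
    by move=> x sx; split => //=; rewrite /I01 /= ler01 lexx.
  - move=> x sx; rewrite /b1 (hat_id sx) sx ifF; last by apply/negbTE; rewrite -ltNge; dlra.
    by congr (f (A (_, _))); dlra.
(* The collar now carries the track backwards, from time 1 at radius 1/2 to time 0 on the sphere. *)
pose a' (x : 'rV[R]_n) := if `|x| <= 2^-1 then a1 (2 *: x) else A (2 - 2 * `|x|, hat x).
have s2 (x : 'rV[R]_n) : `|x| = 2^-1 -> sphere (2 *: x).
  by rewrite /sphere /= norm_gtr// => ->; rewrite divff.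
have h2 (x : 'rV[R]_n) : `|x| = 2^-1 -> hat x = 2 *: x.
  by rewrite /hat => ->; rewrite invrK.
exists a'; split.
- apply: cont_on_if; cont.
  + apply: (cont_on_comp a1c); first by cont.
    by move=> x [_ /= ?]; rewrite /disc /= norm_gtr//; dlra.
  + apply: (cont_on_comp Ac).
      by cont; apply: cont_on_hat => [x [_ /= ?]|]; [dlra|cont].
    move=> x [/= ? ?]; split; first by apply/andP; split => /=; dlra.
    by apply: hat_sphere; dlra.
  + move=> x dx x2; rewrite x2 (h2 _ x2) a1s; last exact: s2.
    by congr (A (_, _)); rewrite divff//; dlra.
- move=> x sx; rewrite /a' (hat_id sx) sx ifF; last by apply/negbTE; rewrite -ltNge; dlra.
  by congr (A (_, _)); dlra.
(* The map between the two homotopies: [G] replaces the inner [f \o a1] by [b1], which leaves [b] on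
   radius 1/4 surrounded by the track run forth and back. *)
pose m (x : 'rV[R]_n) := if `|x| <= 2^-1 then b1 (2 *: x) else f (A (2 - 2 * `|x|, hat x)).
apply: (@rel_homotopic_trans _ _ _ _ m).
  exists (fun z => if `|z.2| <= 2^-1 then G (z.1, 2 *: z.2)
                   else f (A (2 - 2 * `|z.2|, hat z.2))).
  split=> [||||t x].
  - apply: cont_on_if; cont.
    + apply: (cont_on_comp Gc); first by cont.
      by move=> [t x] [[/= ? _] ?]; split => //; rewrite /disc /= norm_gtr//; dlra.
    + apply: (cont_on_comp fAc).
        by cont; apply: cont_on_hat => [x [_ /= ?]|]; [dlra|cont].
      move=> [t x] [[/= ? dx] ?]; rewrite /disc /= in dx.
      split; first by apply/andP; split => /=; dlra.
      by apply: hat_sphere => /=; dlra.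
    + move=> [t x] [/= It dx] x2; rewrite x2 (h2 _ x2) Gs//; last exact: s2.
      rewrite /b1 (hat_id (s2 _ x2)) (s2 _ x2) ifF; last by apply/negbTE; rewrite -ltNge; dlra.
      by congr (f (A (_, _))); rewrite divff//; dlra.
  - move=> x dx /=; rewrite /a'; case: ifPn => // ?.
    by rewrite G0// /disc /= norm_gtr//; dlra.
  - move=> x dx /=; rewrite /m; case: ifPn => // ?.
    by rewrite G1// /disc /= norm_gtr//; dlra.
  - move=> t x It sx /=; rewrite /m.
    by rewrite ifF ?ifF //; apply/negbTE; rewrite -ltNge sx; dlra.
  - move=> It /= dx; rewrite /disc /= in dx.
    case: ifPn => [?|]; last rewrite -ltNge => ?.
      by apply: GV => //; rewrite /disc /= norm_gtr//; dlra.
    by apply: AV; [apply/andP; split; dlra|apply: hat_sphere; dlra].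
(* [r] grows from 1/4 to 1 and is the radius of the disc occupied by [b] at time [t]. Outside it the
   track is followed up to the height of the tent [min (4|x| - 1) (2 - 2|x|)], whose rising side is
   lowered by [3 t] so that it vanishes exactly at [|x| = r t]. *)
pose r t : R := (1 + 3 * t) / 4.
exists (fun z => if `|z.2| <= r z.1 then b ((r z.1)^-1 *: z.2)
                 else f (A (Num.min (4 * `|z.2| - 1 - 3 * z.1) (2 - 2 * `|z.2|), hat z.2))).
have rp t : I01 t -> 0 < r t.
  by move=> /andP[? ?]; rewrite /r; dlra.
have rI t x : I01 t -> disc x -> r t <= `|x| ->
    I01 (Num.min (4 * `|x| - 1 - 3 * t) (2 - 2 * `|x|)).
  move=> /andP[? ?]; rewrite /disc/= => dx; rewrite /r => rx; apply/andP; split.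
    by rewrite le_min; apply/andP; split; dlra.
  by rewrite ge_min; apply/orP; case: (leP `|x| 2^-1) => ?; [left|right]; dlra.
split=> [||||t x].
- apply: cont_on_if; rewrite /r; cont.
  + apply: (cont_on_comp bc).
      by cont => -[t x] [[/= It _] _]; rewrite gt_eqF//; exact: rp.
    move=> [t x] [[/= It dx] ?]; rewrite /disc /=.
    by rewrite norm_gtr ?invr_gt0 ?rp // ler_pdivrMl ?rp// mulr1.
  + apply: (cont_on_comp fAc).
      cont; apply: cont_on_hat => [[t x] [[/= It _] ?]|]; last by cont.
      by apply: lt_le_trans (rp _ It) _.
    move=> [t x] [[/= It dx] rx]; split => /=; first exact: rI.
    by apply: hat_sphere; exact: lt_le_trans (rp _ It) _.
  + move=> [t x] [/= It dx] xr.
    have r0 : 0 < (1 + 3 * t) / 4 by exact: rp.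
    have sx : sphere (((1 + 3 * t) / 4)^-1 *: x).
      by rewrite /sphere /= norm_gtr ?invr_gt0// xr mulVf ?gt_eqF.
    rewrite -fab // xr; rewrite /hat xr; congr (f (A (_, _))).
    rewrite min_l; first dlra.
    by move: It xr dx => /andP[? ?]; rewrite /disc /= => -> ?; dlra.
- move=> x; rewrite /disc /= => dx; rewrite /m /b1 /r mulr0 addr0 norm_gtr//.
  case: (leP `|x| (1 / 4)) => x4.
    rewrite ifT; last dlra.
    rewrite ifT; last dlra.
    by rewrite scalerA; congr (b (_ *: _)); rewrite invfM invrK invr1 mul1r; dlra.
  case: (leP `|x| 2^-1) => x2.
    rewrite ifF; last by apply/negbTE; rewrite -ltNge; dlra.
    rewrite hatZ//; congr (f (A (_, _))); rewrite min_l; dlra.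
  by congr (f (A (_, _))); rewrite min_r; dlra.
- move=> x; rewrite /disc /= => dx; rewrite /r ifT; last dlra.
  by congr b; rewrite (_ : (1 + 3 * 1) / 4 = 1) ?invr1 ?scale1r//; dlra.
- move=> t x It sx /=; rewrite sx /r; move: (It) => /andP[? ?]; case: ifPn => [t1|].
    have -> : t = 1 by dlra.
    by congr b; rewrite (_ : (1 + 3 * 1) / 4 = 1) ?invr1 ?scale1r//; dlra.
  rewrite -ltNge => ?; rewrite -fab // hat_id //; congr (f (A (_, _))).
  by rewrite min_r; dlra.
- move=> It dx /=; case: ifPn => [?|]; last rewrite -ltNge => ?.
    apply: bV; rewrite /disc /=.
    by rewrite norm_gtr ?invr_gt0 ?rp // ler_pdivrMl ?rp// mulr1.
  apply: AV; first by apply: rI => //; exact: ltW.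
  by apply: hat_sphere; apply: lt_trans (rp _ It) _.
Qed.

Lemma lift_solution_eq (T U : topologicalType) n (f : T -> U) (V : set U)
    (a1 a2 : 'rV[R]_n -> T) b : (forall x, sphere x -> a1 x = a2 x) ->
  lift_solution f V a1 b -> lift_solution f V a2 b.
Proof.
by move=> a12 [a' [a'c a's h]]; exists a'; split=> // x sx; rewrite a's// a12.
Qed.

Lemma lift_problem_eq (T U : topologicalType) n (f : T -> U) (V : set U)
    (a1 a2 : 'rV[R]_n -> T) b : (forall x, sphere x -> a1 x = a2 x) ->
  lift_problem f V a1 b -> lift_problem f V a2 b.
Proof.
move=> a12 [a1c bc bV fab]; split=> //; first exact: cont_on_eq a1c.
by move=> x sx; rewrite -a12// fab.
Qed.

(** The boundary datum may be deformed through the preimage of [V] before the problem is solved. All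
    [b1] have to be allowed at the far end, because the deformation changes the map on the disc as
    well. *)
Lemma lift_deform (T U : topologicalType) n (f : T -> U) (V : set U)
    (A : R * 'rV[R]_n -> T) (a0 a1 : 'rV[R]_n -> T) (b : 'rV[R]_n -> U) :
  continuous f -> cont_on (I01 `*` @sphere R n) A ->
  (forall t x, I01 t -> sphere x -> V (f (A (t, x)))) ->
  (forall x, sphere x -> A (0, x) = a0 x) ->
  (forall x, sphere x -> A (1, x) = a1 x) ->
  lift_problem f V a0 b ->
  (forall b1, lift_problem f V a1 b1 -> lift_solution f V a1 b1) ->
  lift_solution f V a0 b.
Proof.
move=> fc Ac AV A0 A1 pb sol; apply: (lift_solution_eq A0).
apply: lift_deform_aux => //.
  by apply: (lift_problem_eq _ pb) => x sx; rewrite A0.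
move=> b1 pb1; apply: (@lift_solution_eq _ _ _ _ _ a1) => [x sx|].
  by rewrite A1.
by apply: sol; exact: lift_problem_eq pb1.
Qed.

(** A lifting problem contains a total function into [T], so there is none when [T] is empty. The
    first clause excludes an empty [T] over a nonempty [V], which is what surjectivity on path
    components requires. *)
Definition lifting_property (T U : topologicalType) (f : T -> U) (V : set U) :=
  (forall u, V u -> inhabited T) /\
  forall n (a : 'rV[R]_n -> T) (b : 'rV[R]_n -> U),
    lift_problem f V a b -> lift_solution f V a b.

End Lifting.
Arguments lifting_property R {T U} f V.

(** * Weak homotopy equivalences and lifting properties *)

Section Coordinates.
Context {R : realType} {T : topologicalType} (A : set T).

Lemma cont_on_sum (V : normedModType R) (I : Type) (r : seq I) (P : pred I)
    (f : I -> T -> V) : (forall i, cont_on A (f i)) ->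
  cont_on A (fun x => \sum_(i <- r | P i) f i x).
Proof.
move=> fc; elim: r => [|i r IH].
  by apply: (@cont_on_eq _ _ _ (fun=> 0)) => [x _|]; [rewrite big_nil|cont].
case: (boolP (P i)) => Pi.
  apply: (@cont_on_eq _ _ _ (fun x => f i x + \sum_(i <- r | P i) f i x)).
    by move=> x _; rewrite big_cons Pi.
  exact: cont_onD.
by apply: cont_on_eq IH => x _; rewrite big_cons (negbTE Pi).
Qed.

Lemma cont_on_row n (f : 'I_n -> T -> R) :
  (forall i, cont_on A (f i)) -> cont_on A (fun x => \row_i f i x).
Proof.
move=> fc; apply: (@cont_on_eq _ _ _ (fun x => \sum_i f i x *: delta_mx 0 i)).
  move=> x _; rewrite [RHS]row_sum_delta; apply: eq_bigr => i _.
  by rewrite mxE.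
apply: cont_on_sum => i; apply: cont_onZ => //; exact: cont_on_cst.
Qed.

Lemma cont_on_coord n (f : T -> 'rV[R]_n) i :
  cont_on A f -> cont_on A (fun x => f x ord0 i).
Proof.
move=> fc; apply: (@cont_on_compT _ _ _ A f (fun v : 'rV[R]_n => v ord0 i)) => //.
exact: coord_continuous.
Qed.

Lemma cont_on_ptws (I : Type) (K : topologicalType) (g : T -> {ptws I -> K}) :
  (forall i, cont_on A (fun x => g x i)) -> cont_on A g.
Proof.
move=> gc x Ax; apply/cvg_sup => i O [B [[C oC <-] Cx] BO].
have /cont_onP/(_ x Ax C) := gc i.
move=> /(_ (open_nbhs_nbhs (conj oC Cx))); apply: filterS => y yC Ay.
by apply: BO; exact: yC.
Qed.

Lemma cont_on_set_type (K : topologicalType) (B : set K) (g : T -> set_type B) :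
  cont_on A (fun x => val (g x)) -> cont_on A g.
Proof.
move=> /cont_onP gc x Ax O [B' [[C oC <-] Cx] BO].
have := gc x Ax C (open_nbhs_nbhs (conj oC Cx)); apply: filterS => y yC Ay.
by apply: BO; exact: yC.
Qed.

End Coordinates.

Lemma set_val_continuous (K : topologicalType) (B : set K) :
  continuous (val : set_type B -> K).
Proof. exact: initial_continuous. Qed.

Lemma ptws_proj_continuous (I : eqType) (K : topologicalType) (i : I) :
  continuous (fun g : {ptws I -> K} => g i).
Proof. exact: (@proj_continuous I (fun=> K)). Qed.

(** * The sup norm and the splitting of a row into first coordinate and tail *)

Section RowNorm.
Context {R : realType}.

Lemma row_normP n (x : 'rV[R]_n) (r : R) : 0 <= r ->
  `|x| <= r <-> forall i, `|x ord0 i| <= r.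
Proof.
move=> r0; rewrite /Num.norm /= mx_normrE; split.
  by move=> /bigmax_leP[_ xr] i; exact: (xr (ord0, i)).
by move=> xr; apply/bigmax_leP; split=> // -[i j] _ /=; rewrite (ord1 i); exact: xr.
Qed.

Lemma row_coord_le n (x : 'rV[R]_n) i : `|x ord0 i| <= `|x|.
Proof. by move: i; apply/row_normP. Qed.

Lemma row_norm_attained n (x : 'rV[R]_n) : `|x| != 0 ->
  exists i, `|x| = `|x ord0 i|.
Proof.
move=> /mx_norm_neq0[[i j] /= xij]; exists j; move: xij.
by rewrite (ord1 i).
Qed.

Lemma sphere_coordP n (x : 'rV[R]_n) : disc x ->
  sphere x <-> exists i, x ord0 i = 1 \/ x ord0 i = -1.
Proof.
rewrite /disc /sphere /= => dx; split=> [sx|[i xi]].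
  have [|i xi] := @row_norm_attained _ x; first by rewrite sx.
  exists i; move: xi; rewrite sx => /esym/eqP; rewrite eqr_norml ler01 andbT.
  by case/orP => /eqP; [left|right].
apply/eqP; rewrite eq_le dx /=; apply: le_trans (row_coord_le x i).
by case: xi => ->; rewrite ?normrN normr1.
Qed.

(** The first coordinate plays the role of time: the disc of dimension [n.+1] is a prism over that
    of dimension [n], and its sphere consists of top, bottom and sides. *)
Definition cons_row n (s : R) (y : 'rV[R]_n) : 'rV[R]_n.+1 :=
  \row_i oapp (y ord0) s (unlift ord0 i).
Definition tail_row n (x : 'rV[R]_n.+1) : 'rV[R]_n := \row_i x ord0 (lift ord0 i).

Lemma cons_row0 n s (y : 'rV[R]_n) : cons_row s y ord0 ord0 = s.
Proof. by rewrite mxE unlift_none. Qed.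

Lemma cons_rowS n s (y : 'rV[R]_n) i : cons_row s y ord0 (lift ord0 i) = y ord0 i.
Proof. by rewrite mxE liftK. Qed.

Lemma tail_rowK n s (y : 'rV[R]_n) : tail_row (cons_row s y) = y.
Proof. by apply/rowP => i; rewrite mxE cons_rowS. Qed.

Lemma cons_tail_row n (x : 'rV[R]_n.+1) : cons_row (x ord0 ord0) (tail_row x) = x.
Proof.
apply/rowP => i; case: (unliftP ord0 i) => [j ->|->]; rewrite ?cons_row0//.
by rewrite cons_rowS mxE.
Qed.

Lemma cons_row_disc n s (y : 'rV[R]_n) : -1 <= s <= 1 -> disc y -> disc (cons_row s y).
Proof.
move=> s1 dy; apply/row_normP => // i; case: (unliftP ord0 i) => [j ->|->].
  by rewrite cons_rowS; apply: le_trans (row_coord_le y j) _.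
by rewrite cons_row0 ler_norml.
Qed.

Lemma tail_row_disc n (x : 'rV[R]_n.+1) : disc x -> disc (tail_row x).
Proof.
move=> dx; apply/row_normP => // i; rewrite mxE.
exact: le_trans (row_coord_le _ _) dx.
Qed.

Lemma sphere_consP n (x : 'rV[R]_n.+1) : disc x -> sphere x <->
  [\/ x ord0 ord0 = 1, x ord0 ord0 = -1 | sphere (tail_row x)].
Proof.
move=> dx; have tP := sphere_coordP (tail_row_disc dx).
rewrite sphere_coordP //; split.
  move=> [i]; case: (unliftP ord0 i) => [j ->|->].
    by move=> xj; apply: Or33; apply/tP; exists j; rewrite mxE.
  by case; [apply: Or31|apply: Or32].
case=> [x0|x0|/tP[j]]; [by exists ord0; left|by exists ord0; right|].
by rewrite mxE => xj; exists (lift ord0 j).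
Qed.

Lemma cont_on_cons_row (T : topologicalType) (A : set T) n (s : T -> R)
    (y : T -> 'rV[R]_n) : cont_on A s -> cont_on A y ->
  cont_on A (fun x => cons_row (s x) (y x)).
Proof.
move=> sc yc; apply: cont_on_row => i; case: (unliftP ord0 i) => [j _|_] //=.
exact: cont_on_coord.
Qed.

Lemma cont_on_tail_row (T : topologicalType) (A : set T) n (y : T -> 'rV[R]_n.+1) :
  cont_on A y -> cont_on A (fun x => tail_row (y x)).
Proof. by move=> yc; apply: cont_on_row => i; exact: cont_on_coord. Qed.

End RowNorm.

(** * Passage between the disc and the unit cube *)

Section Cube.
Context {R : realType}.

Definition clamp (r : R) : R := Num.max 0 (Num.min r 1).

Lemma clamp_unit r : unit_int (clamp r).
Proof.
by rewrite /unit_int /clamp /= le_max lexx ge_max ler01 ge_min lexx orbT.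
Qed.

Lemma clamp_id r : 0 <= r <= 1 -> clamp r = r.
Proof. by move=> /andP[r0 r1]; rewrite /clamp min_l// max_r. Qed.

Definition clampI (r : R) : set_type (@unit_int R) := SigSub (mem_set (clamp_unit r)).

Lemma val_clampI r : 0 <= r <= 1 -> val (clampI r) = r.
Proof. exact: clamp_id. Qed.

Lemma val_clampI0 : val (clampI 0) = 0.
Proof. by rewrite val_clampI// lexx ler01. Qed.

Lemma val_clampI1 : val (clampI 1) = 1.
Proof. by rewrite val_clampI// lexx ler01. Qed.

Lemma clampIK (t : set_type (@unit_int R)) : clampI (val t) = t.
Proof. by apply/val_inj/clamp_id; exact: set_mem (valP t). Qed.

Lemma unit_intP (t : set_type (@unit_int R)) : 0 <= val t <= 1.
Proof. exact: set_mem (valP t). Qed.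

(** The affine identification of [[-1, 1]^n] with [[0, 1]^n]. Clamping makes it total and continuous
    on all rows; it inverts [of_cube] on the disc. *)
Definition to_cube n (x : 'rV[R]_n) : cube R n :=
  fun i => clampI ((x ord0 i + 1) / 2).
Definition of_cube n (c : cube R n) : 'rV[R]_n := \row_i (2 * val (c i) - 1).

Lemma of_cube_disc n (c : cube R n) : disc (of_cube c).
Proof.
apply/row_normP => // i; rewrite mxE ler_norml.
by have /andP[? ?] := unit_intP (c i); apply/andP; split; lra.
Qed.

Lemma of_cubeK n (c : cube R n) : to_cube (of_cube c) = c.
Proof.
apply/funext => i; rewrite /to_cube mxE -[RHS]clampIK; congr clampI.
by lra.
Qed.

Lemma to_cubeK n (x : 'rV[R]_n) : disc x -> of_cube (to_cube x) = x.
Proof.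
move=> dx; apply/rowP => i; rewrite mxE /to_cube val_clampI; first lra.
have := le_trans (row_coord_le x i) dx; rewrite ler_norml => /andP[? ?].
by apply/andP; split; lra.
Qed.

Lemma of_cube_sphere n (c : cube R n) : sphere (of_cube c) <-> cube_bdry c.
Proof.
rewrite sphere_coordP; last exact: of_cube_disc.
by split=> -[i]; rewrite ?mxE => -[] ?; exists i; rewrite ?mxE; [right|left|right|left]; lra.
Qed.

Lemma to_cube_bdry n (x : 'rV[R]_n) : sphere x -> cube_bdry (to_cube x).
Proof. by move=> sx; apply/of_cube_sphere; rewrite to_cubeK //; exact: sphere_disc. Qed.

Lemma cont_on_clampI (T : topologicalType) (A : set T) (s : T -> R) :
  cont_on A s -> cont_on A (fun x => clampI (s x)).
Proof.
move=> sc; apply: cont_on_set_type => /=; rewrite /clamp.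
by cont.
Qed.

Lemma cont_on_to_cube (T : topologicalType) (A : set T) n (y : T -> 'rV[R]_n) :
  cont_on A y -> cont_on A (fun x => to_cube (y x)).
Proof.
move=> yc; apply: cont_on_ptws => i; apply: cont_on_clampI.
by cont; exact: cont_on_coord.
Qed.

Lemma cont_on_of_cube (T : topologicalType) (A : set T) n (c : T -> cube R n) :
  cont_on A c -> cont_on A (fun x => of_cube (c x)).
Proof.
move=> cc; apply: cont_on_row => i.
cont.
apply: (cont_on_compT (@set_val_continuous _ _)).
exact: (cont_on_compT (@ptws_proj_continuous _ _ i) cc).
Qed.

End Cube.

Lemma whe_lifting_inhabited (R : realType) (T U : topologicalType) (f : T -> U) :
  weak_homotopy_equivalence R f -> forall u : U, inhabited T.
Proof. by move=> [_ surj _] u; have [x _] := surj u. Qed.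

Section WheLifting.
Context {R : realType} {T U : topologicalType} (f : T -> U).

(** Surjectivity on homotopy groups is a problem with constant boundary datum. For injectivity the
    given homotopy fills a prism whose bottom and top are labelled [h1] and [h2], and the solution
    on the prism is the homotopy in [T]. Path components are the case [n = 0], with its empty
    sphere. *)
Lemma lifting_whe : continuous f -> lifting_property R f setT ->
  weak_homotopy_equivalence R f.
Proof.
move=> fc [inh sol]; split=> //.
  move=> y; have [t0] := inh y I.
  have [|a' [_ _ [H [Hc H0 H1 _ _]]]] := sol 0%N (fun=> t0) (fun=> y).
    split; cont => // x; rewrite /sphere /=.
    by rewrite (_ : x = 0) ?normr0 => [/esym/eqP|]; [rewrite oner_eq0|apply/rowP => -[]].
  have d0 : disc (0 : 'rV[R]_0) by rewrite /disc /= normr0.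
  exists (a' 0), (fun z => H (val z.1, 0)); split.
  - apply: cont_on_continuous; apply: (cont_on_comp Hc); last first.
      by move=> [t c] _; split => //; exact: unit_intP.
    cont; apply: (cont_on_compT (@set_val_continuous _ _)); cont.
  - by move=> t c /= ->; rewrite H0.
  - by move=> t c /= ->; rewrite H1.
  - by move=> t c [[]].
move=> n x; split.
  move=> g [gc gb]; have [|a' [a'c a's [H [Hc H0 H1 Hs _]]]] :=
      sol n (fun=> x) (fun z => g (to_cube z)).
    split=> //.
    - exact: cont_on_cst.
    - by apply: (cont_on_compT gc); apply: cont_on_to_cube; cont.
    - by move=> z sz /=; rewrite gb//; exact: to_cube_bdry.
  exists (a' \o @of_cube R n); split; first split.
  - apply: cont_on_continuous; apply: (cont_on_comp a'c).
      by apply: cont_on_of_cube; cont.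
    by move=> c _; exact: of_cube_disc.
  - by move=> c bc /=; rewrite a's//; apply/of_cube_sphere.
  - exists (fun z => H (val z.1, of_cube z.2)); split.
    + apply: cont_on_continuous; apply: (cont_on_comp Hc); last first.
        by move=> [t c] _; split => /=; [exact: unit_intP|exact: of_cube_disc].
      cont; last by apply: cont_on_of_cube; cont.
      by apply: (cont_on_compT (@set_val_continuous _ _)); cont.
    + by move=> t c /= ->; rewrite H0//; exact: of_cube_disc.
    + by move=> t c /= ->; rewrite H1 /= ?of_cubeK//; exact: of_cube_disc.
    + move=> t c bc /=; rewrite Hs /= ?of_cubeK ?gb//; first exact: unit_intP.
      exact/of_cube_sphere.
move=> h1 h2 [h1c h1b] [h2c h2b] [H [Hc H0 H1 Hb]].
(* Switching at height 0 is harmless: a point of the sphere at that height lies on a side, where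
   [h1] and [h2] both equal [x]. *)
pose a (z : 'rV[R]_n.+1) := if z ord0 ord0 <= 0 then h1 (to_cube (tail_row z))
                            else h2 (to_cube (tail_row z)).
pose b (z : 'rV[R]_n.+1) := H (clampI ((z ord0 ord0 + 1) / 2), to_cube (tail_row z)).
have ccoord (A : set 'rV[R]_n.+1) : cont_on A (fun z => z ord0 ord0 : R).
  by apply: cont_on_coord; cont.
have ctail (A : set 'rV[R]_n.+1) : cont_on A (fun z => to_cube (tail_row z)).
  by apply: cont_on_to_cube; apply: cont_on_tail_row; cont.
have [|a' [a'c a's _]] := sol n.+1 a b.
  split=> //.
  - apply: cont_on_if; rewrite /=.
    + exact: ccoord.
    + by cont.
    + exact: cont_on_compT.
    + exact: cont_on_compT.
    + move=> z sz z0; have /(sphere_consP (sphere_disc sz)) := sz.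
      rewrite z0 => -[|/eqP|sy]; [by move/esym/eqP; rewrite oner_eq0|by rewrite eq_sym oppr_eq0 oner_eq0|].
      by rewrite h1b ?h2b//; exact: to_cube_bdry.
  - apply: (cont_on_compT Hc); cont; last exact: ctail.
    by apply: cont_on_clampI; cont; exact: ccoord.
  - move=> z sz; have /(sphere_consP (sphere_disc sz)) := sz; rewrite /a /b => -[z1|z1|sy].
    + rewrite z1 ler10 H1 //; rewrite val_clampI; first lra.
      by apply/andP; split; lra.
    + rewrite z1 lerN10 H0 //.
      rewrite val_clampI; first lra.
      by apply/andP; split; lra.
    + by rewrite Hb; last exact: to_cube_bdry; case: ifP => _; rewrite ?h1b ?h2b//; exact: to_cube_bdry.
have consI (t : set_type (@unit_int R)) (c : cube R n) : disc (cons_row (2 * val t - 1) (of_cube c)).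
  apply: cons_row_disc; last exact: of_cube_disc.
  by have /andP[? ?] := unit_intP t; apply/andP; split; lra.
exists (fun z => a' (cons_row (2 * val z.1 - 1) (of_cube z.2))); split.
- apply: cont_on_continuous; apply: (cont_on_comp a'c); last by move=> [t c] _.
  apply: cont_on_cons_row; last by apply: cont_on_of_cube; cont.
  by cont; apply: (cont_on_compT (@set_val_continuous _ _)); cont.
- move=> t c /= t0; rewrite a's; last first.
    by apply/(sphere_consP (consI _ _)); rewrite cons_row0; apply: Or32; rewrite /= t0; lra.
  by rewrite /a cons_row0 tail_rowK of_cubeK ifT// t0; lra.
- move=> t c /= t1; rewrite a's; last first.
    by apply/(sphere_consP (consI _ _)); rewrite cons_row0; apply: Or31; rewrite /= t1; lra.
  by rewrite /a cons_row0 tail_rowK of_cubeK ifF// t1; apply/negbTE; rewrite -ltNge; lra.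
- move=> t c bc; rewrite a's; last first.
    by apply/(sphere_consP (consI _ _)); apply: Or33; rewrite tail_rowK; apply/of_cube_sphere.
  by rewrite /a tail_rowK of_cubeK h1b ?h2b//; case: ifP.
Qed.

Hypothesis fwe : weak_homotopy_equivalence R f.

Let fc : continuous f. Proof. by case: fwe. Qed.

(** If [a] extends over the disc, the radial contraction deforms it to the constant [a 0]. A problem
    with constant boundary datum is a based cube in [U], and surjectivity on homotopy groups solves
    it. *)
Lemma lift_extended n (a : 'rV[R]_n -> T) b : cont_on (@disc R n) a ->
  lift_problem f setT a b -> lift_solution f setT a b.
Proof.
move=> ac pb; have d0 : disc (0 : 'rV[R]_n) by rewrite /disc /= normr0.
apply: (@lift_deform _ _ _ _ f setT (fun z => a ((1 - z.1) *: z.2)) a (fun=> a 0)) => //.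
- apply: (cont_on_comp ac); first by cont.
  move=> [t x] [/= /andP[? ?] sx]; rewrite /disc /= normrZ sx mulr1 ger0_norm; lra.
- by move=> x _ /=; rewrite subr0 scale1r.
- by move=> x _ /=; rewrite subrr scale0r.
move=> b1 [_ b1c _ b1s].
case: fwe => _ _ /(_ n (a 0))[+ _] => /(_ (b1 \o @of_cube R n)) [].
  split; last by move=> c /of_cube_sphere sc /=; rewrite -b1s.
  apply: cont_on_continuous; apply: (cont_on_comp b1c).
    by apply: cont_on_of_cube; cont.
  by move=> c _; exact: of_cube_disc.
move=> h [[hc hb] [H [Hc H0 H1 Hb]]].
exists (h \o @to_cube R n); split.
- by apply: (cont_on_compT hc); apply: cont_on_to_cube; cont.
- by move=> x sx /=; rewrite hb//; exact: to_cube_bdry.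
exists (fun z => H (clampI z.1, to_cube z.2)); split=> //.
- by apply: (cont_on_compT Hc); cont; [apply: cont_on_clampI|apply: cont_on_to_cube]; cont.
- by move=> x dx; rewrite (H0 _ _ val_clampI0).
- by move=> x dx; rewrite (H1 _ _ val_clampI1) /= to_cubeK.
- by move=> t x It sx; rewrite Hb; [exact: b1s|exact: to_cube_bdry].
Qed.

(** On the top face [a] is a based cube in [T], and the horizontal slices of [b] contract its image
    in [U]. Injectivity on homotopy groups contracts it in [T], which extends [a] over the disc and
    reduces the problem to [lift_extended]. *)
Lemma lift_top_face n (a : 'rV[R]_n.+1 -> T) b x0 :
  (forall x, sphere x -> x ord0 ord0 = -1 \/ sphere (tail_row x) -> a x = x0) ->
  lift_problem f setT a b -> lift_solution f setT a b.
Proof.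
move=> aJ pb; have [ac bc _ fab] := pb.
have consI (s : R) (c : cube R n) : -1 <= s <= 1 -> disc (cons_row s (of_cube c)).
  by move=> ?; apply: cons_row_disc => //; exact: of_cube_disc.
have topS (c : cube R n) : sphere (cons_row 1 (of_cube c)).
  apply/sphere_consP; first by apply: consI; apply/andP; split; lra.
  by apply: Or31; rewrite cons_row0.
case: fwe => _ _ /(_ n x0)[_] /(_ (fun c => a (cons_row 1 (of_cube c))) (fun=> x0)) [].
- split.
    apply: cont_on_continuous; apply: (cont_on_comp ac); last by move=> c _; exact: topS.
    by apply: cont_on_cons_row; cont; apply: cont_on_of_cube; cont.
  move=> c bdc; apply: aJ => //; right; rewrite tail_rowK; exact/of_cube_sphere.
- by split=> //; apply: cont_on_continuous; exact: cont_on_cst.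
(* Time runs downwards from the top face at height 1 to the bottom face at height -1. *)
- exists (fun z => b (cons_row (1 - 2 * val z.1) (of_cube z.2))).
  have tI (t : set_type (@unit_int R)) : -1 <= 1 - 2 * val t <= 1.
    by have /andP[? ?] := unit_intP t; apply/andP; split; lra.
  split.
  + apply: cont_on_continuous; apply: (cont_on_comp bc); last by move=> [t c] _; exact: consI.
    apply: cont_on_cons_row; last by apply: cont_on_of_cube; cont.
    by cont; apply: (cont_on_compT (@set_val_continuous _ _)); cont.
  + by move=> t c /= ->; rewrite mulr0 subr0 /= fab.
  + move=> t c /= ->; rewrite mulr1 (_ : 1 - 2 = -1 :> R); last by lra.
    have sx : sphere (cons_row (-1) (of_cube c)).
      apply/sphere_consP; first by apply: consI; apply/andP; split; lra.
      by apply: Or32; rewrite cons_row0.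
    by rewrite -fab// aJ//; left; rewrite cons_row0.
  + move=> t c bdc /=.
    have sx : sphere (cons_row (1 - 2 * val t) (of_cube c)).
      by apply/sphere_consP; [exact: consI|apply: Or33; rewrite tail_rowK; apply/of_cube_sphere].
    by rewrite -fab// aJ//; right; rewrite tail_rowK; exact/of_cube_sphere.
move=> G [Gc G0 G1 Gb].
pose a' (x : 'rV[R]_n.+1) := G (clampI ((1 - x ord0 ord0) / 2), to_cube (tail_row x)).
have a'a x : sphere x -> a' x = a x.
  move=> sx; have dx := sphere_disc sx.
  have /(sphere_consP dx) [x1|x1|sy] := sx.
  - rewrite /a' x1 G0; last by rewrite val_clampI; [lra|apply/andP; split; lra].
    by rewrite to_cubeK -?x1 ?cons_tail_row//; exact: tail_row_disc.
  - rewrite /a' x1 G1; last by rewrite val_clampI; [lra|apply/andP; split; lra].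
    by rewrite aJ//; left.
  - rewrite /a' Gb; last exact: to_cube_bdry.
    by rewrite aJ//; right.
apply: (lift_solution_eq a'a); apply: lift_extended; last first.
  by apply: lift_problem_eq pb => x sx; rewrite a'a.
apply: (cont_on_compT Gc); cont.
  by apply: cont_on_clampI; cont; apply: cont_on_coord; cont.
by apply: cont_on_to_cube; apply: cont_on_tail_row; cont.
Qed.

(* The sphere is pushed away from the pole [e], so that the complement of the
   face centred at [e] ends up at [- e]. *)
Lemma whe_lifting : lifting_property R f setT.
Proof.
split=> [u _|]; first exact: whe_lifting_inhabited fwe u.
case=> [|n] a b pb.
  have x0 (x : 'rV[R]_0) : x = 0 by apply/rowP => -[].
  have [_ /(_ (b 0))[x [H [Hc H0 H1 _]]] _] := fwe.
  have ns (z : 'rV[R]_0) : ~ sphere z.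
    by rewrite (x0 z) /sphere /= normr0 => /esym/eqP; rewrite oner_eq0.
  exists (fun=> x); split; [by cont|by move=> z /ns|].
  exists (fun z => H (clampI z.1, to_cube z.2)); split=> //.
  - by apply: (cont_on_compT Hc); cont; [apply: cont_on_clampI|apply: cont_on_to_cube]; cont.
  - by move=> z dz; rewrite (H0 _ _ val_clampI0).
  - by move=> z dz; rewrite (H1 _ _ val_clampI1) (x0 z).
  - by move=> t z _ /ns.
have [ac bc _ fab] := pb.
pose e : 'rV[R]_n.+1 := cons_row 1 0.
have se : sphere e.
  apply/sphere_consP; last by apply: Or31; rewrite cons_row0.
  by apply: cons_row_disc; rewrite ?lexx ?andbT /disc /= ?normr0//; lra.
have sNe : sphere (- e) by rewrite /sphere /= normrN.
(* [psi] vanishes at [e] and is 1 on the bottom and the sides, which have sup distance at least 1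
   from [e]. [M] moves [x] along the segment towards [- e]. It could reach the origin only if
   [x = e] with weight 1/2, but the weight at [e] is 0. *)
pose psi (x : 'rV[R]_n.+1) := Num.min 1 `|x - e|.
have psi01 x : 0 <= psi x <= 1 by rewrite /psi le_min ler01 normr_ge0 ge_min lexx.
pose M (z : R * 'rV[R]_n.+1) := (1 - z.1 * psi z.2) *: z.2 - (z.1 * psi z.2) *: e.
have M0 z : (I01 `*` @sphere R n.+1) z -> 0 < `|M z|.
  case: z => t x [/= /andP[t0 t1] sx]; rewrite normr_gt0; apply/eqP => /= Mx0.
  have := psi01 x; set q := psi x => /andP[q0 q1].
  have tq : 0 <= t * q <= 1 by rewrite mulr_ge0//= mulr_ile1.
  move: Mx0; rewrite /M /= -/q => /eqP; rewrite subr_eq0 => /eqP Mx0.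
  have := congr1 Num.norm Mx0; rewrite !normrZ sx se !mulr1.
  case/andP: tq => tq0 tq1; rewrite !ger0_norm ?subr_ge0// => tq2.
  have xe : x = e.
    have : t * q != 0 by apply/eqP => tq0'; move: tq2; rewrite tq0' subr0 => /eqP; rewrite oner_eq0.
    by rewrite tq2 in Mx0; move=> ?; apply: (scalerI _ Mx0).
  have q00 : q = 0 by rewrite /q /psi xe subrr normr0 min_r.
  by move: tq2; rewrite q00 mulr0 subr0 => /eqP; rewrite oner_eq0.
apply: (@lift_deform _ _ _ _ f setT (fun z => a (hat (M z))) a (fun x => a (hat (M (1, x))))) => //.
- apply: (cont_on_comp ac); last by move=> z Az; apply: hat_sphere; exact: M0.
  by apply: cont_on_hat; [exact: M0|rewrite /M /psi; cont].
- by move=> x sx; rewrite /M mul0r subr0 scale1r scale0r subr0 hat_id.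
move=> b1; apply: lift_top_face (a (- e)) _ => x sx xJ.
suff q1 : psi x = 1 by rewrite /M /= q1 mul1r subrr scale0r scale1r sub0r hat_id.
rewrite /psi min_l//; case: xJ => [x1|sy].
  apply: le_trans (row_coord_le _ ord0); rewrite !mxE unlift_none /= x1.
  by rewrite ler0_norm; lra.
have [i yi] : exists i, `|tail_row x ord0 i| = 1.
  have [|i] := @row_norm_attained _ _ (tail_row x); first by rewrite sy oner_eq0.
  by rewrite sy => yi; exists i.
apply: le_trans (row_coord_le _ (lift ord0 i)); rewrite !mxE liftK /= mxE subr0.
by move: yi; rewrite mxE => ->.
Qed.

End WheLifting.

(** * Homotopy extension and lifting *)

Section Glue.
Context {Z W : topologicalType} (A B : set Z) (f g : Z -> W).
Hypothesis fg : forall z, A z -> B z -> f z = g z.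

Definition paste z := if pselect (A z) then f z else g z.

Lemma pasteL z : A z -> paste z = f z.
Proof. by rewrite /paste; case: pselect. Qed.

Lemma pasteR z : B z -> paste z = g z.
Proof. by rewrite /paste; case: pselect => // Az Bz; exact: fg. Qed.

Lemma paste_cont : closed A -> closed B -> cont_on A f -> cont_on B g ->
  cont_on (A `|` B) paste.
Proof.
move=> cA cB fc gc; apply: cont_on_glue => //.
  by apply: cont_on_eq fc => z Az; rewrite pasteL.
by apply: cont_on_eq gc => z Bz; rewrite pasteR.
Qed.

End Glue.

Lemma I01_closed (R : realType) : closed (@I01 R).
Proof.
rewrite (_ : I01 = `[0, 1]%classic); first exact: itv_closed.
by apply/seteqP; split=> x /=; rewrite in_itv.
Qed.

Lemma closed_setX (T U : topologicalType) (A : set T) (B : set U) :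
  closed A -> closed B -> closed (A `*` B).
Proof.
move=> cA cB; rewrite (_ : A `*` B = fst @^-1` A `&` snd @^-1` B) //.
apply: closedI; apply: closed_comp => // x _; [exact: cvg_fst|exact: cvg_snd].
Qed.

Section Help.
Context {R : realType} {T U : topologicalType} (f : T -> U) (V : set U).

(* The homotopy extension and lifting property of the pair [(D, S)]. *)
Definition help_pair (Z : topologicalType) (D S : set Z) :=
  forall (a : Z -> T) (b : Z -> U) (h : R * Z -> U),
  cont_on S a -> cont_on D b -> cont_on (I01 `*` S) h ->
  (forall x, D x -> V (b x)) -> (forall t x, I01 t -> S x -> V (h (t, x))) ->
  (forall x, S x -> h (0, x) = f (a x)) -> (forall x, S x -> h (1, x) = b x) ->
  exists (a' : Z -> T) (H : R * Z -> U),
  [/\ cont_on D a' /\ cont_on (I01 `*` D) H,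
      (forall x, S x -> a' x = a x) /\
        (forall t x, I01 t -> S x -> H (t, x) = h (t, x)),
      (forall x, D x -> H (0, x) = f (a' x)),
      (forall x, D x -> H (1, x) = b x) &
      (forall t x, I01 t -> D x -> V (H (t, x)))].

Lemma help_refl (Z : topologicalType) (D : set Z) : help_pair D D.
Proof. by move=> a b h ac bc hc bV hV h0 h1; exists a, h; split. Qed.

Lemma help_trans (Z : topologicalType) (D C S : set Z) : S `<=` C -> C `<=` D ->
  help_pair D C -> help_pair C S -> help_pair D S.
Proof.
move=> SC CD hD hC a b h ac bc hc bV hV h0 h1.
have [||a1 [H1 [[a1c H1c] [a1S H1S] H10 H11 H1V]]] := hC a b h ac _ hc _ hV h0 h1.
- exact: cont_on_sub bc.
- by move=> x Cx; apply: bV; exact: CD.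
have [a2 [H2 [? [a2C H2C] ? ? ?]]] := hD a1 b H1 a1c bc H1c bV H1V H10 H11.
exists a2, H2; split=> //; split=> [x Sx|t x It Sx].
  by rewrite a2C ?a1S//; exact: SC.
by rewrite H2C ?H1S//; exact: SC.
Qed.

(** Excision: the data on [A] enter the problem on [C] only through the intersection, and the
    solution on [C] is pasted to the given data on [A]. *)
Lemma help_attach (Z : topologicalType) (C A : set Z) : closed A -> closed C ->
  help_pair C (C `&` A) -> help_pair (A `|` C) A.
Proof.
move=> cA cC hC a b h ac bc hc bV hV h0 h1.
have [|||||||a1 [H1 [[a1c H1c] [a1S H1S] H10 H11 H1V]]] := hC a b h.
- by apply: cont_on_sub ac => x [].
- by apply: cont_on_sub bc => x; right.
- by apply: cont_on_sub hc => x [? []].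
- by move=> x Cx; apply: bV; right.
- by move=> t x It [_ Ax]; exact: hV.
- by move=> x [_ Ax]; exact: h0.
- by move=> x [_ Ax]; exact: h1.
have aE x : A x -> C x -> a x = a1 x by move=> Ax Cx; rewrite a1S.
have hE w : (I01 `*` A) w -> (I01 `*` C) w -> h w = H1 w.
  by case: w => t x [/= It Ax] [_ /= Cx]; rewrite H1S.
exists (paste A a a1), (paste (I01 `*` A) h H1); split; first split.
- exact: paste_cont.
- apply: (@cont_on_sub _ _ _ ((I01 `*` A) `|` (I01 `*` C))).
    by move=> w [? [?|?]]; [left|right].
  by apply: paste_cont => //; apply: closed_setX => //; exact: I01_closed.
- by split=> [x Ax|t x It Ax]; rewrite pasteL.
- move=> x [Ax|Cx]; first by rewrite !pasteL ?h0//; split=> //=; rewrite /I01 /= lexx ler01.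
  by rewrite (pasteR aE Cx) (pasteR hE) ?H10//; split=> //=; rewrite /I01 /= lexx ler01.
- move=> x [Ax|Cx]; first by rewrite !pasteL ?h1//; split=> //=; rewrite /I01 /= lexx ler01.
  by rewrite (pasteR hE) ?H11//; split=> //=; rewrite /I01 /= lexx ler01.
- move=> t x It [Ax|Cx]; first by rewrite pasteL//; exact: hV.
  by rewrite (pasteR hE)//; exact: H1V.
Qed.

(** [(D', S')] is a retract of [(D, S)]: data are pulled back along [e], solutions along [r]. *)
Lemma help_transport (Z Z' : topologicalType) (D S : set Z) (D' S' : set Z')
    (e : Z -> Z') (r : Z' -> Z) : S `<=` D -> S' `<=` D' ->
  cont_on D e -> cont_on D' r ->
  (forall x, D x -> D' (e x)) -> (forall x, S x -> S' (e x)) ->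
  (forall x, D' x -> D (r x)) -> (forall x, S' x -> S (r x)) ->
  (forall x, D' x -> e (r x) = x) ->
  help_pair D S -> help_pair D' S'.
Proof.
move=> SD SD' ec rc eD eS rD rS er hD a b h ac bc hc bV hV h0 h1.
have ecS : cont_on S e by exact: cont_on_sub ec.
have [|||||||a1 [H1 [[a1c H1c] [a1S H1S] H10 H11 H1V]]] :=
    hD (fun z => a (e z)) (fun z => b (e z)) (fun w => h (w.1, e w.2)).
- exact: (cont_on_comp ac).
- exact: (cont_on_comp bc).
- apply: (cont_on_comp hc); last by move=> [t x] [/= ? ?]; split=> //=; exact: eS.
  by cont; apply: (cont_on_comp ecS); [cont|move=> [t x] []].
- by move=> x Dx; apply: bV; exact: eD.
- by move=> t x It Sx; apply: hV => //; exact: eS.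
- by move=> x Sx; rewrite h0//; exact: eS.
- by move=> x Sx; rewrite h1//; exact: eS.
exists (fun z => a1 (r z)), (fun w => H1 (w.1, r w.2)); split; first split.
- exact: (cont_on_comp a1c).
- apply: (cont_on_comp H1c); last by move=> [t x] [/= ? ?]; split=> //=; exact: rD.
  by cont; apply: (cont_on_comp rc); [cont|move=> [t x] []].
- split=> [x Sx|t x It Sx].
    by rewrite a1S ?er//; [exact: SD'|exact: rS].
  by rewrite H1S /= ?er//; [exact: SD'|exact: rS].
- by move=> x Dx /=; rewrite H10//; exact: rD.
- by move=> x Dx /=; rewrite H11 ?er//; exact: rD.
- by move=> t x It Dx /=; apply: H1V => //; exact: rD.
Qed.

Hypothesis lp : lifting_property R f V.

(** The lifting property only gives homotopies fixed on the sphere. The prescribed [h] is therefore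
    attached to [b] as an outer collar, the problem is solved on the enlarged disc, and the
    resulting homotopy is reparametrised so that the collar is swept out in time. *)
Lemma help_disc n : help_pair (@disc R n) (@sphere R n).
Proof.
move=> a b h ac bc hc bV hV h0 h1; have [_ sol] := lp.
(* Between radius 1 and radius 2 the collar runs through [h] from time 1 back to time 0; beyond
   radius 2 it is radially constant, equal to [f (a (hat x))]. *)
pose B (x : 'rV[R]_n) := if `|x| <= 1 then b x else h (Num.max 0 (2 - `|x|), hat x).
have Bc : cont_on setT B.
  apply: cont_on_if; cont.
  - by apply: cont_on_sub bc => x [].
  - apply: (cont_on_comp hc).
      by cont; apply: cont_on_hat; cont => x [_ /= ?]; lra.
    move=> x [_ /= ?]; split; last by apply: hat_sphere; lra.
    by rewrite /I01 /= le_max lexx ge_max ler01 /=; lra.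
  - move=> x _ x1; rewrite x1 hat_id// -h1//; congr (h (_, _)).
    by rewrite max_r; lra.
have BV x : V (B x).
  rewrite /B; case: ifPn => [|]; first exact: bV.
  rewrite -ltNge => x1; apply: hV; last by apply: hat_sphere; lra.
  by rewrite /I01 /= le_max lexx ge_max ler01 /=; lra.
have B2 x : 2 <= `|x| -> B x = f (a (hat x)).
  move=> x2; rewrite /B ifF; last by apply/negbTE; rewrite -ltNge; lra.
  by rewrite max_l -?h0//; [apply: hat_sphere; lra|lra].
have sB x : sphere x -> B (2 *: x) = f (a x).
  by move=> sx; rewrite B2 ?hatZ ?hat_id// norm_gtr// sx mulr1.
have [|a' [a'c a's [G [Gc G0 G1 Gs GV]]]] := sol n a (fun x => B (2 *: x)).
  split=> //; last by move=> x sx; rewrite sB.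
  by apply: (cont_on_comp Bc) => //; cont.
pose a2 (x : 'rV[R]_n) := if `|x| <= 2^-1 then a' (2 *: x) else a (hat x).
(* The dilation used outside the block [max |x| t <= 1/2] occupied by [G]. The summand [2 - t] reads
   off [h] on the sphere and [b] at [t = 1]. The factor 10 makes [c = 4] at [t = 1/2] on the inner
   disc, matching the end [B (4 x)] of [G]. It also keeps [|c x| >= 2], where [B] is radially
   constant, both at [t = 0] outside the inner disc and on the lateral boundary of the block. *)
pose c (w : R * 'rV[R]_n) := 2 - w.1 + 10 * (1 - w.1) * Num.min (1 - `|w.2|) (2^-1).
pose H (w : R * 'rV[R]_n) := if Num.max `|w.2| w.1 <= 2^-1 then G (2 * w.1, 2 *: w.2)
                             else B (c w *: w.2).
have dbl (x : 'rV[R]_n) : `|x| <= 2^-1 -> disc (2 *: x).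
  by move=> ?; rewrite /disc /= norm_gtr//; lra.
have dblS (x : 'rV[R]_n) : `|x| = 2^-1 -> sphere (2 *: x).
  by move=> x2; rewrite /sphere /= norm_gtr// x2 divff.
exists a2, H; split; first split.
- apply: cont_on_if; cont.
  + by apply: (cont_on_comp a'c); [cont|move=> x [_]; exact: dbl].
  + apply: (cont_on_comp ac).
      by apply: cont_on_hat; cont => x [_ /= ?]; lra.
    by move=> x [_ /= ?]; apply: hat_sphere; lra.
  + by move=> x dx x2; rewrite a's ?/hat ?x2 ?invrK//; exact: dblS.
- apply: cont_on_if; cont.
  + apply: (cont_on_comp Gc); first by cont.
    move=> [t x] [[/= /andP[? ?] _]]; rewrite ge_max => /andP[x2 t2].
    by split=> /=; [apply/andP; split; lra|exact: dbl].
  + by apply: (cont_on_comp Bc) => //; rewrite /c; cont.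
  + move=> [t x] [/= /andP[t0 t1] dx] m2; rewrite /c /=.
    case: (leP `|x| t) m2 => [xt t2|tx x2].
      rewrite t2 divff// G1; last by apply: dbl; rewrite -t2.
      rewrite scalerA min_r; last by rewrite -t2; lra.
      by congr (B (_ *: _)); lra.
    rewrite Gs; [|by apply/andP; split; lra|exact: dblS].
    rewrite sB; last exact: dblS.
    rewrite x2 min_r; last lra.
    rewrite B2 ?hatZ//; last 2 first.
    + by lra.
    + by rewrite norm_gtr ?x2; lra.
    by rewrite /hat x2 invrK.
- split=> [x sx|t x /andP[t0 t1] sx].
    by rewrite /a2 sx hat_id// ifF//; apply/negbTE; rewrite -ltNge; lra.
  rewrite /H /c /= sx subrr min_l; last lra.
  rewrite mulr0 addr0 ifF; last by apply/negbTE; rewrite -ltNge lt_max; lra.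
  rewrite /B norm_gtr ?sx ?mulr1; last lra.
  case: ifPn => [t1'|]; last rewrite -ltNge => t1'.
    have -> : t = 1 by lra.
    by rewrite (_ : 2 - 1 = 1) ?scale1r ?h1//; lra.
  have t2 : 0 < 2 - t by lra.
  rewrite hatZ// hat_id// max_r; last lra.
  by congr (h (_, _)); lra.
- move=> x dx; rewrite /H /a2 /= ge_max invr_ge0 ler0n andbT.
  case: ifPn => [x2|]; first by rewrite mulr0 G0//; exact: dbl.
  rewrite -ltNge => x2; rewrite /c /= min_l; last lra.
  have cp : 0 < 2 - 0 + 10 * (1 - 0) * (1 - `|x|) by dlra.
  by rewrite B2 ?hatZ// norm_gtr//; move: dx; rewrite /disc /= => dx; nra.
- move=> x dx; rewrite /H ifF /c /=.
    by rewrite subrr mulr0 mul0r addr0 (_ : 2 - 1 = 1) ?scale1r /B ?dx//; lra.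
  by apply/negbTE; rewrite -ltNge lt_max; apply/orP; right; lra.
- move=> t x /andP[t0 t1] dx; rewrite /H; case: ifPn => // ; rewrite ge_max => /andP[x2 t2].
  by apply: GV; [apply/andP; split; rewrite /= in t2 *; lra|exact: dbl].
Qed.

End Help.

(** * Cubical complexes in a grid *)

Lemma nat_dist (R : realType) (j k c : nat) :
  (`|j%:R - k%:R| <= c%:R :> R) = (j <= k + c)%N && (k <= j + c)%N.
Proof.
rewrite ler_norml lerBlDr -natrD ler_nat lerNl opprB lerBlDr -natrD ler_nat.
by rewrite andbC addnC [(c + j)%N]addnC.
Qed.

Lemma nat_dist_lt (R : realType) (j k c : nat) :
  (`|j%:R - k%:R| < c%:R :> R) = (j < k + c)%N && (k < j + c)%N.
Proof.
rewrite ltr_norml ltrBlDr -natrD ltr_nat ltrNl opprB ltrBlDr -natrD ltr_nat.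
by rewrite andbC addnC [(c + j)%N]addnC.
Qed.

Section Grid.
Context {R : realType} (n N : nat).
Local Notation cell := {ffun 'I_n -> 'I_(2 * N).+1}.
Local Notation rV := 'rV[R]_n.
Implicit Types (e : cell) (z : rV) (S : {set cell}).

(* Odd coordinates stand for unit-radius intervals around [e i], even ones for
   the point [e i]. *)
Definition ccell e : set rV :=
  [set z : rV | forall i, `|z ord0 i - (e i : nat)%:R| <= (odd (e i))%:R].
Definition cbd e : set rV :=
  [set z : rV | ccell e z /\ exists i, odd (e i) /\ `|z ord0 i - (e i : nat)%:R| = 1].
Definition ocell e : set rV :=
  [set z : rV | forall i, if odd (e i) then `|z ord0 i - (e i : nat)%:R| < 1 : Prop
                     else z ord0 i = (e i : nat)%:R].
Definition box : set rV := [set z : rV | forall i, 0 <= z ord0 i <= (2 * N)%:R].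

Definition face e e' := forall i, e i = e' i :> nat \/
  odd (e' i) /\ (e i = (e' i).+1 :> nat \/ (e i).+1 = e' i :> nat).
Definition facecl S := forall e e', face e e' -> e' \in S -> e \in S.
Definition ucells S : set rV := [set z : rV | exists2 e, e \in S & ccell e z].

Lemma ccell_box e z : ccell e z -> box z.
Proof.
move=> ez i; have := ez i; rewrite ler_norml => /andP[].
have := ltn_ord (e i); rewrite ltnS; case: (boolP (odd (e i))) => oi le_e /=.
  have e1 : (1 <= e i)%N by case: (e i : nat) oi.
  have e2 : ((e i).+1 <= 2 * N)%N.
    by rewrite ltn_neqAle le_e andbT; apply: contraL oi => /eqP ->; rewrite oddM.
  rewrite -(@ler_nat R) in e1; rewrite -(@ler_nat R) -natr1 in e2.
  by move=> ? ?; apply/andP; split; lra.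
rewrite -(@ler_nat R) in le_e; have := ler0n R (e i) => ? ? ?.
by apply/andP; split; lra.
Qed.

Lemma ocell_ccell e z : ocell e z -> ccell e z.
Proof.
move=> ez i; have := ez i; case: ifP => _; first exact: ltW.
by move=> ->; rewrite subrr normr0.
Qed.

Lemma ccell_cases e z : ccell e z -> ocell e z \/ cbd e z.
Proof.
move=> ez; have [|] := pselect (exists i, odd (e i) /\ `|z ord0 i - (e i : nat)%:R| = 1).
  by right.
move=> /forallNP ni; left => i; have := ez i; case: ifPn => oi /=.
  by rewrite le_eqVlt => /orP[/eqP|//] eq1; case: (ni i).
by rewrite normr_le0 subr_eq0 => /eqP.
Qed.

Lemma ocell_cbd e z : ocell e z -> cbd e z -> False.
Proof. by move=> oz [_ [i [oi]]]; have := oz i; rewrite oi => /lt_eqF/eqP. Qed.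

(** One common point decides incidence, by parity: distinct odd centres are at distance at least 2.
    Together with [carrier] this turns geometric intersections of cells into statements about
    face-closed families. *)
Lemma ocell_face e e' z : ocell e z -> ccell e' z -> face e e'.
Proof.
move=> oz cz i; have := oz i; have := cz i; case: ifPn => oe; last first.
  move=> + ze; rewrite ze nat_dist; case: (odd (e' i)) => /=.
    by move=> h; have [->|ne] := eqVneq (e i : nat) (e' i); [left|right; split=> //]; lia.
  by move=> h; left; lia.
case: (boolP (odd (e' i))) => oe' /= z1 z2; left.
  have : `|(e i : nat)%:R - (e' i : nat)%:R| < 2%:R :> R.
    rewrite -[X in `|X|](subrKA (z ord0 i)) (le_lt_trans (ler_normD _ _))//.
    by rewrite distrC; lra.
  rewrite nat_dist_lt => h; have [//|ne] := eqVneq (e i : nat) (e' i).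
  have : (e i = (e' i).+1 :> nat \/ (e i).+1 = e' i :> nat) by lia.
  by case=> h'; [move: oe; rewrite h' /= oe'|move: oe'; rewrite -h' /= oe].
move: z1; rewrite normr_le0 subr_eq0 => /eqP z1; move: z2; rewrite z1.
by rewrite (nat_dist_lt _ _ _ 1) => h; lia.
Qed.

Lemma face_ccell e e' : face e e' -> ccell e `<=` ccell e'.
Proof.
move=> fe z ez i; have := ez i; case: (fe i) => [->//|[oe' ee']].
have oe : odd (e i) = false.
  by case: ee' => ee'; [rewrite ee' /= oe'|move: oe'; rewrite -ee' /= => /negbTE].
rewrite oe oe' normr_le0 subr_eq0 => /eqP ->; rewrite nat_dist.
by case: ee' => ee'; lia.
Qed.

(** With [k] the integer part of a coordinate, take [k] if the coordinate equals [k], and otherwise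
    the odd one of [k] and [k + 1], whose open unit interval contains the coordinate. *)
Lemma carrier z : box z -> exists e, ocell e z.
Proof.
move=> bz.
have /fin_all_exists [e ez] : forall i, exists j : 'I_(2 * N).+1,
    if odd j then `|z ord0 i - (j : nat)%:R| < 1 : Prop else z ord0 i = (j : nat)%:R.
  move=> i; have /andP[z0 zN] := bz i.
  have := truncn_itv z0; set k := Num.trunc _; rewrite -natr1 => /andP[kz zk].
  have kN : (k <= 2 * N)%N by rewrite -(@ler_nat R); exact: le_trans kz zN.
  have [->|zk'] := eqVneq (z ord0 i) k%:R.
    have [ok|ok] := boolP (odd k).
      by exists (inord k); rewrite inordK ?ltnS// ok subrr normr0.
    by exists (inord k); rewrite inordK ?ltnS// (negbTE ok).
  have kz' : k%:R < z ord0 i by rewrite lt_neqAle eq_sym zk'.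
  have [ok|ok] := boolP (odd k).
    by exists (inord k); rewrite inordK ?ltnS// ok ltr_norml; apply/andP; split; lra.
  have kN' : (k < 2 * N)%N by rewrite -(@ltr_nat R); exact: lt_le_trans kz' zN.
  exists (inord k.+1); rewrite inordK ?ltnS//= ok -natr1 ltr_norml.
  by apply/andP; split; lra.
by exists [ffun i => e i] => i; rewrite ffunE; exact: ez.
Qed.

Lemma ucellsI S1 S2 z : facecl S1 -> facecl S2 -> ucells S1 z -> ucells S2 z ->
  ucells (S1 :&: S2) z.
Proof.
move=> f1 f2 [e1 e1S c1] [e2 e2S c2]; have [e oe] := carrier (ccell_box c1).
exists e; last exact: ocell_ccell.
rewrite inE; apply/andP; split.
  by apply: f1 e1S; exact: (ocell_face oe c1).
by apply: f2 e2S; exact: (ocell_face oe c2).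
Qed.

Lemma ucellsS S1 S2 : S1 \subset S2 -> ucells S1 `<=` ucells S2.
Proof. by move=> /fintype.subsetP s12 z [e eS ez]; exists e => //; exact: s12. Qed.

Lemma ucellsU S1 S2 : ucells (S1 :|: S2) = ucells S1 `|` ucells S2.
Proof.
apply/seteqP; split=> z.
  by move=> [e]; rewrite inE => /orP[] eS ez; [left|right]; exists e.
by case; apply: ucellsS; [exact: finset.subsetUl|exact: finset.subsetUr].
Qed.

Lemma faceclI S1 S2 : facecl S1 -> facecl S2 -> facecl (S1 :&: S2).
Proof.
by move=> f1 f2 e e' ee'; rewrite !inE => /andP[? ?]; rewrite (f1 _ e')// (f2 _ e').
Qed.

Lemma faceclU S1 S2 : facecl S1 -> facecl S2 -> facecl (S1 :|: S2).
Proof.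
move=> f1 f2 e e' ee'; rewrite !inE => /orP[?|?].
  by rewrite (f1 _ e').
by rewrite (f2 _ e')// orbT.
Qed.

Lemma ccell_closed e : closed (ccell e).
Proof.
rewrite (_ : ccell e = \bigcap_(i in [set: 'I_n])
    [set z : rV | `|z ord0 i - (e i : nat)%:R| <= (odd (e i))%:R]); last first.
  by apply/seteqP; split=> [z ez i _|z ez i]; [exact: ez|exact: (ez i I)].
apply: closed_bigI => i _.
apply: (@closed_comp _ _ (fun z : rV => `|z ord0 i - (e i : nat)%:R|)
          [set r : R | r <= (odd (e i))%:R]) => [z _|]; last exact: closed_le.
move: z; apply: cont_on_continuous; cont; apply: cont_on_coord; exact: cont_on_id.
Qed.

Lemma ucells_closed S : closed (ucells S).
Proof.
rewrite (_ : ucells S = \bigcup_(e in [set` S]) ccell e); last first.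
  by apply/seteqP; split=> z [e]; exists e.
by apply: closed_bigcup => [|e _]; [exact: finite_finset|exact: ccell_closed].
Qed.

(** The number of odd coordinates is the dimension of the cell. *)
Lemma face_dim e e' : face e e' -> e != e' ->
  (#|[pred i | odd (e i)]| < #|[pred i | odd (e' i)]|)%N.
Proof.
move=> fe ne; apply: proper_card; apply/properP; split.
  apply/fintype.subsetP => i; rewrite !inE; case: (fe i) => [->//|[-> //]].
have [i nei] : exists i, e i != e' i.
  by apply/existsP; apply: contraNT ne; rewrite negb_exists => /forallP h;
     apply/eqP/ffunP => i; apply/eqP; rewrite -[_ == _]negbK; exact: h.
exists i; rewrite inE; case: (fe i) => [ee'|[oe' [] ee']] //.
- by move: nei; rewrite -val_eqE /= ee' eqxx.
- by move: nei; rewrite -val_eqE /= ee' eqxx.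
- by rewrite ee' /= oe'.
- by move: oe'; rewrite -ee'.
Qed.

(** A relatively interior point of [e] inside the complex would force [e] into the face-closed [S];
    conversely the carrier of a boundary point is a proper face of [e]. *)
Lemma ccell_ucells S e : facecl S -> e \notin S ->
  (forall e', face e' e -> e' != e -> e' \in S) ->
  ccell e `&` ucells S = cbd e.
Proof.
move=> fS eS fe; apply/seteqP; split=> z.
  move=> [ez [e' e'S e'z]]; have [oz|//] := ccell_cases ez.
  by move/negP: eS; case; apply: fS e'S; exact: (ocell_face oz e'z).
move=> bz; have [ez _] := bz; split=> //.
have [e' oz] := carrier (ccell_box ez); exists e'; last exact: ocell_ccell.
apply: fe; first exact: (ocell_face oz ez).
by apply/eqP => e'e; move: oz; rewrite e'e => /ocell_cbd; exact.
Qed.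

Section HelpComplex.
Context {T U : topologicalType} (f : T -> U) (V : set U).
Hypothesis lp : lifting_property R f V.

(** Up to translation the cell is a disc in its odd coordinates, enumerated by [enum_val], with the
    even ones frozen; hence [help_disc] transports to it. *)
Lemma help_ccell e : help_pair (R := R) f V (ccell e) (cbd e).
Proof.
pose A := [pred i | odd (e i)]; pose m := #|A|.
pose emb (y : 'rV[R]_m) : rV :=
  \row_i ((e i : nat)%:R + \sum_(j < m | enum_val j == i) y ord0 j).
pose pr (z : rV) : 'rV[R]_m :=
  \row_j (z ord0 (enum_val j) - (e (enum_val j) : nat)%:R).
have embV y j : emb y ord0 (enum_val j) = (e (enum_val j) : nat)%:R + y ord0 j.
  by rewrite mxE; congr (_ + _); rewrite (big_pred1 j)// => k; rewrite (inj_eq enum_val_inj).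
have embN y i : ~~ odd (e i) -> emb y ord0 i = (e i : nat)%:R.
  move=> oi; rewrite mxE big_pred0 ?addr0// => j; apply/negbTE; apply: contraNneq oi => <-.
  by have := enum_valP j; rewrite inE.
have oddE i : odd (e i) -> exists j : 'I_m, i = enum_val j.
  by move=> oi; have iA : i \in A by [rewrite inE]; exists (enum_rank_in iA i); rewrite enum_rankK_in.
have enumA (j : 'I_m) : odd (e (enum_val j)) by have := enum_valP j; rewrite inE.
have embD y : disc y -> ccell e (emb y).
  move=> dy i; have [oi|oi] := boolP (odd (e i)); last by rewrite embN// subrr normr0.
  have [j ->] := oddE _ oi; rewrite embV addrC addKr.
  exact: le_trans (row_coord_le _ _) dy.
have prD z : ccell e z -> disc (pr z).
  by move=> ez; apply/row_normP => // j; rewrite mxE (le_trans (ez _))// enumA.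
have embS y : sphere y -> cbd e (emb y).
  move=> sy; split; first exact/embD/sphere_disc.
  have [|j yj] := @row_norm_attained _ _ y; first by rewrite sy oner_eq0.
  by exists (enum_val j); split=> //; rewrite embV addrC addKr -yj.
have prS z : cbd e z -> sphere (pr z).
  move=> [ez [i [oi zi]]]; apply/eqP; rewrite eq_le prD//=.
  have [j ij] := oddE _ oi; apply: le_trans (row_coord_le _ j).
  by rewrite mxE -ij zi.
apply: (@help_transport _ _ _ f V _ _ (@disc R m) (@sphere R m) _ _ emb pr) => //.
- by move=> y; exact: sphere_disc.
- by move=> z [].
- by apply: cont_on_row => i; cont; apply: cont_on_sum => j; apply: cont_on_coord; cont.
- by apply: cont_on_row => i; cont; apply: cont_on_coord; cont.
- move=> z ez; apply/rowP => i; have [oi|oi] := boolP (odd (e i)).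
    by have [j ->] := oddE _ oi; rewrite embV mxE addrC subrK.
  rewrite embN//; have := ez i; rewrite (negbTE oi) normr_le0 subr_eq0.
  by move=> /eqP.
- exact: help_disc.
Qed.

(** Missing cells are attached one at a time, least dimension first, so that the proper faces of
    each new cell are already present and it meets the complex exactly in [cbd]. *)
Lemma help_ucells S S' : facecl S -> facecl S' -> S \subset S' ->
  help_pair (R := R) f V (ucells S') (ucells S).
Proof.
move=> + fS'; have [k] := ubnP #|S' :\: S|; elim: k S => // k IH S le_k fS sSS'.
have [S'S|/fintype.subsetPn[e0 e0S' e0S]] := boolP (S' \subset S).
  have -> : S = S' by apply/eqP; rewrite finset.eqEsubset sSS'.
  exact: help_refl.
have e0D : e0 \in S' :\: S by rewrite inE e0S e0S'.
case: (arg_minnP (fun e : cell => #|[pred i | odd (e i)]|) e0D) => e /finset.setDP[eS' eS] mine.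
have fe e' : face e' e -> e' != e -> e' \in S.
  move=> fe ne; apply: contraT => ne'S.
  have e'D : e' \in S' :\: S by rewrite inE ne'S (fS' _ e).
  by have := mine _ e'D; rewrite leqNgt (face_dim fe ne).
have fS1 : facecl (e |: S).
  move=> e1 e2 f12; rewrite !inE => /orP[/eqP e2e|e2S]; last by rewrite (fS _ e2)// orbT.
  by have [//|ne] := eqVneq e1 e; rewrite fe// -e2e.
have s1 : e |: S \subset S' by rewrite finset.subUset sSS' andbT finset.sub1set.
apply: (@help_trans _ _ _ f V _ _ (ucells (e |: S))).
- exact/ucellsS/finset.subsetUr.
- exact: ucellsS.
- apply: IH => //; apply: leq_trans (proper_card _) le_k.
  apply/properP; split; first by apply: finset.setDS; exact: finset.subsetUr.
  by exists e; rewrite !inE ?eqxx// eS.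
rewrite ucellsU setUC (_ : ucells [set e]%SET = ccell e); last first.
  apply/seteqP; split=> z; first by move=> [e']; rewrite inE => /eqP ->.
  by exists e => //; rewrite inE.
apply: help_attach; [exact: ucells_closed|exact: ccell_closed|].
by rewrite ccell_ucells//; exact: help_ccell.
Qed.

End HelpComplex.

End Grid.

(** * Lifting properties over a union of two open sets *)

Section OpenUnion.
Context {R : realType}.

Lemma disc_compact n : compact (@disc R n).
Proof.
apply: bounded_closed_compact.
  by exists 1; split=> // M M1 x /= dx; apply: le_trans dx (ltW M1).
apply: (@closed_comp _ _ (fun x : 'rV[R]_n => `|x|) [set r : R | r <= 1]) => [x _|].
  exact: norm_continuous.
exact: closed_le.
Qed.

(** Each point of the disc has a neighbourhood and a threshold for [d] that work together;
    compactness, in its near-covering form with the filter of small positive [d], makes the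
    threshold uniform. *)
Lemma lebesgue_number (U : topologicalType) n (b : 'rV[R]_n -> U) (V1 V2 : set U) :
  cont_on (@disc R n) b -> open V1 -> open V2 ->
  (forall x, disc x -> (V1 `|` V2) (b x)) ->
  exists2 d : R, 0 < d & forall x, disc x ->
    (forall y, disc y -> `|x - y| < d -> V1 (b y)) \/
    (forall y, disc y -> `|x - y| < d -> V2 (b y)).
Proof.
move=> /cont_onP bc o1 o2 bV.
pose Q (W : set U) (d : R) x := forall y, disc y -> `|x - y| < d -> W (b y).
have near_Q W x : open W -> disc x -> W (b x) ->
    \forall x' \near x & d \near 0^'+, Q W d x'.
  move=> oW dx Wx; have := bc x dx W (open_nbhs_nbhs (conj oW Wx)).
  move=> /nbhs_ballP[e /= e0 eW].
  have e20 : 0 < e / 2 by lra.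
  exists (ball x (e / 2), [set d | d < e / 2]).
    by split; [exact: nbhsx_ballx|exact: nbhs_right_lt].
  move=> [x' d] [/= xx' de] y dy x'y; apply: eW => //.
  apply: (ball_split xx'); rewrite -ball_normE /ball_ /=.
  exact: lt_trans de.
have /compact_near_coveringP/(_ R 0^'+ (fun d x => Q V1 d x \/ Q V2 d x)) := @disc_compact n.
move=> cov; have QF : \forall d \near 0^'+, @disc R n `<=` (fun x => Q V1 d x \/ Q V2 d x).
  apply: cov => x dx; have [V1x|V2x] := bV x dx.
    by apply: filterS (near_Q _ _ o1 dx V1x) => z; left.
  by apply: filterS (near_Q _ _ o2 dx V2x) => z; right.
have QF' : \forall d \near (0 : R)^'+,
    @disc R n `<=` (fun x => Q V1 d x \/ Q V2 d x) /\ 0 < d.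
  by apply: filterI => //; exact: nbhs_right_gt.
have [d [Qd d0]] := @filter_ex _ _ (at_right_proper_filter (0 : R)) _ QF'.
by exists d.
Qed.

(** Cells mapped into both sets are solved first, inside the intersection, so that their homotopy is
    an admissible datum over [V1] as well as over [V2]. The two solutions extending it agree on the
    overlap, which by [ucellsI] is made of exactly those cells. *)
Lemma lifting_setU (T U : topologicalType) (f : T -> U) (V1 V2 : set U) :
  open V1 -> open V2 ->
  lifting_property R f V1 -> lifting_property R f V2 ->
  lifting_property R f (V1 `&` V2) -> lifting_property R f (V1 `|` V2).
Proof.
move=> o1 o2 l1 l2 l12; split=> [u [Vu|Vu]|n a b [ac bc bV fab]].
- by case: l1 => + _; apply; exact: Vu.
- by case: l2 => + _; apply; exact: Vu.
have [d d0 leb] := lebesgue_number bc o1 o2 bV.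
(* The scaling [sc] sends [[0, 2N]^n] to the disc and unit radii to [1/N < d], so every point of a
   cell is closer than [d] to its centre. *)
pose N := (Num.trunc d^-1).+1.
have Nd : N%:R^-1 < d.
  by rewrite invf_plt ?posrE// /N truncnS_gt.
have N0 : 0 < N%:R :> R by rewrite ltr0n.
have Nn0 : N%:R != 0 :> R by rewrite gt_eqF.
pose sc (z : 'rV[R]_n) : 'rV[R]_n := \row_i (N%:R^-1 * z ord0 i - 1).
pose usc (x : 'rV[R]_n) : 'rV[R]_n := \row_i (N%:R * (x ord0 i + 1)).
have scK x : sc (usc x) = x by apply/rowP => i; rewrite !mxE mulKf// addrK.
have uscK z : usc (sc z) = z by apply/rowP => i; rewrite !mxE subrK mulVKf.
have scD z : box N z -> disc (sc z).
  move=> bz; apply/row_normP => // i; rewrite mxE ler_norml.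
  have /andP[z0 zN] := bz i.
  have z0' : 0 <= N%:R^-1 * z ord0 i by rewrite mulr_ge0// invr_ge0 ltW.
  have zN' : N%:R^-1 * z ord0 i <= 2 by rewrite ler_pdivrMl// mulrC -natrM.
  by apply/andP; split; lra.
have uscD x : disc x -> box N (usc x).
  move=> dx i; rewrite mxE natrM.
  have := le_trans (row_coord_le x i) dx; rewrite ler_norml => /andP[x0 x1].
  apply/andP; split; first by apply: mulr_ge0; [exact: ltW|lra].
  by rewrite mulrC ler_pM2r//; lra.
have scc (A : set 'rV[R]_n) : cont_on A sc.
  by apply: cont_on_row => i; cont; apply: cont_on_coord; cont.
have uscc (A : set 'rV[R]_n) : cont_on A usc.
  by apply: cont_on_row => i; cont; apply: cont_on_coord; cont.
pose cell := {ffun 'I_n -> 'I_(2 * N).+1}.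
pose be z := b (sc z); pose al z := a (sc z).
pose inV (W : set U) (e : cell) := forall z, ccell (R := R) e z -> W (be z).
pose S (W : set U) : {set cell} := [set e : cell | `[< inV W e >]]%SET.
have SE W e : (e \in S W) <-> (forall z, ccell (R := R) e z -> W (be z)).
  by rewrite inE; split=> [/asboolP //|h]; exact/asboolP.
have SP W z : ucells (S W) z -> W (be z).
  by move=> [e /SE]; exact.
have Scl W : facecl (S W).
  move=> e e' fe /SE h; apply/SE => z ez.
  by apply: h; exact: (face_ccell fe).
have Sall (z : 'rV[R]_n) : box N z -> (ucells (S V1) `|` ucells (S V2)) z.
  move=> /carrier[e oz]; have ez := ocell_ccell oz.
  pose ctr : 'rV[R]_n := \row_i (e i : nat)%:R.
  have ectr : ccell e ctr by move=> i; rewrite mxE subrr normr0.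
  have near_ctr z' : ccell e z' -> `|sc ctr - sc z'| < d.
    move=> ez'; apply: le_lt_trans Nd; apply/row_normP; first by rewrite invr_ge0 ltW.
    move=> i; rewrite !mxE (_ : _ - _ = N%:R^-1 * ((e i : nat)%:R - z' ord0 i)); last by lra.
    rewrite normrM ger0_norm ?invr_ge0 ?(ltW N0)// ler_piMr ?invr_ge0 ?(ltW N0)//.
    rewrite distrC; apply: le_trans (ez' i) _; by case: (odd _).
  have [h|h] := leb (sc ctr) (scD _ (ccell_box ectr)).
    left; exists e => //; apply/SE => z' ez'.
    by apply: h; [exact/scD/(ccell_box ez')|exact: near_ctr].
  right; exists e => //; apply/SE => z' ez'.
  by apply: h; [exact/scD/(ccell_box ez')|exact: near_ctr].
(* Boundary cells have a coordinate frozen at 0 or [2 N]. Both are even, so passing to a face does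
   not change that coordinate. *)
pose B : {set cell} :=
  [set e : cell | [exists i, (e i == 0 :> nat)%N || (e i == (2 * N) :> nat)%N]]%SET.
have even2 (j : nat) : (j == 0)%N || (j == 2 * N)%N -> ~~ odd j.
  by case/orP => /eqP ->; rewrite ?oddM.
have Bcl : facecl B.
  move=> e e' fe; rewrite !inE => /existsP[i ei]; apply/existsP; exists i.
  by case: (fe i) => [->//|[oe' _]]; have := even2 _ ei; rewrite oe'.
have rbox (Q : {set cell}) (z : 'rV[R]_n) : ucells Q z -> box N z.
  by move=> [e _]; exact: ccell_box.
have BS (z : 'rV[R]_n) : ucells B z -> sphere (sc z).
  move=> Bz; have bz := rbox _ _ Bz; case: Bz => e; rewrite inE => /existsP[i ei] ez.
  apply/(sphere_coordP (scD _ bz)); exists i; rewrite mxE.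
  have := ez i; rewrite (negbTE (even2 _ ei)) normr_le0 subr_eq0 => /eqP ->.
  case/orP: ei => /eqP ->; [right|left]; first by rewrite mulr0 sub0r.
  by rewrite natrM mulrC mulfK//; lra.
have SB x : sphere x -> ucells B (usc x).
  move=> sx; have dx := sphere_disc sx; have [e oz] := carrier (uscD _ dx).
  exists e; last exact: ocell_ccell.
  have /(sphere_coordP dx) [i xi] := sx; rewrite inE; apply/existsP; exists i.
  have [j jj zj] : exists2 j : nat, (j == 0)%N || (j == 2 * N)%N & usc x ord0 i = j%:R.
    case: xi => xi; [exists (2 * N)%N|exists 0%N]; rewrite ?eqxx ?orbT// mxE xi.
      by rewrite natrM mulrC.
    by rewrite addNr mulr0.
  have := oz i; rewrite zj; case: ifPn => oi.
    rewrite (nat_dist_lt _ _ _ 1) => jei; have {jei} ej : e i = j :> nat by lia.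
    by have := even2 _ jj; rewrite -ej oi.
  by move=> /eqP; rewrite eqr_nat => /eqP <-.
have bec : cont_on (box N) be by exact: (cont_on_comp bc).
have alc : cont_on (ucells B) al by exact: (cont_on_comp ac).
have fal z : ucells B z -> f (al z) = be z by move=> /BS; exact: fab.
have recS (Q : {set cell}) : cont_on (ucells Q) be.
  by apply: cont_on_sub bec; exact: rbox.
have rec2 (Q : {set cell}) : cont_on (I01 `*` ucells Q) (fun w : R * 'rV[R]_n => be w.2).
  by apply: (cont_on_comp (recS Q)); [cont|move=> [t z] []].
pose S12 := S V1 :&: S V2.
have cl12 : facecl S12 by exact: faceclI.
have B12 : @ucells R _ _ (S12 :&: B) `<=` ucells B by apply: ucellsS; exact: finset.subsetIr.
have S12V z : ucells S12 z -> (V1 `&` V2) (be z).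
  move=> Sz; split; apply: SP; apply: ucellsS Sz.
    exact: finset.subsetIl.
  exact: finset.subsetIr.
have s12B : S12 :&: B \subset S12 by exact: finset.subsetIl.
(* The homotopy prescribed on boundary cells is stationary, since the final one must be relative to
   the sphere. *)
have [|||a12 [H12 [[a12c H12c] [a12B H12B] H120 H121 H12V]]] :=
  @help_ucells R n N T U f (V1 `&` V2) l12 _ _ (faceclI cl12 Bcl) cl12 s12B
    al be (fun w => be w.2) (cont_on_sub B12 alc) (recS S12) (rec2 _) S12V.
- by move=> t z _ Sz; apply: S12V; exact: ucellsS Sz.
- by move=> z /B12 Bz; rewrite fal.
- by [].
have I0 : I01 (0 : R) by rewrite /I01 /= lexx ler01.
have I1 : I01 (1 : R) by rewrite /I01 /= lexx ler01.
(* The datum over [W] is [a12], [H12] on the common cells and the stationary one on boundary cells;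
   they are compatible because the common cells were solved relative to [B]. *)
have step (W : set U) : lifting_property R f W -> S12 \subset S W ->
    V1 `&` V2 `<=` W -> exists (a1 : 'rV[R]_n -> T) (H1 : R * 'rV[R]_n -> U),
    [/\ cont_on (ucells (S W)) a1 /\ cont_on (I01 `*` ucells (S W)) H1,
        (forall z, ucells S12 z -> a1 z = a12 z) /\
          (forall t z, I01 t -> ucells S12 z -> H1 (t, z) = H12 (t, z)),
        (forall z, ucells (S W) z -> ucells B z -> a1 z = al z) /\
          (forall t z, I01 t -> ucells (S W) z -> ucells B z -> H1 (t, z) = be z),
        (forall z, ucells (S W) z -> H1 (0, z) = f (a1 z) /\ H1 (1, z) = be z) &
        (forall t z, I01 t -> ucells (S W) z -> W (H1 (t, z)))].
  move=> lW sW VW; pose BW := B :&: S W.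
  have BWB : @ucells R _ _ BW `<=` ucells B by apply: ucellsS; exact: finset.subsetIl.
  have BWS : @ucells R _ _ BW `<=` ucells (S W) by apply: ucellsS; exact: finset.subsetIr.
  have clBW : facecl BW by exact: faceclI.
  have ov (z : 'rV[R]_n) : ucells S12 z -> ucells BW z -> ucells (S12 :&: B) z.
    by move=> z1 /BWB z2; exact: ucellsI.
  have aov z : ucells S12 z -> ucells BW z -> a12 z = al z.
    by move=> z1 z2; rewrite a12B//; exact: ov.
  have hov w : (I01 `*` ucells S12) w -> (I01 `*` ucells BW) w -> H12 w = be w.2.
    by case: w => t z [/= It z1] [_ /= z2]; rewrite H12B//; exact: ov.
  have clU : facecl (S12 :|: BW) by exact: faceclU.
  have sU : S12 :|: BW \subset S W by rewrite finset.subUset sW finset.subsetIr.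
  have [||||||a1 [H1 [c1 [a1S H1S] H10 H11 H1W]]] :=
    @help_ucells R n N T U f W lW _ _ clU (Scl W) sU
      (paste (ucells S12) a12 al) be (paste (I01 `*` ucells S12) H12 (fun w => be w.2))
      _ (recS _).
  - rewrite ucellsU; apply: paste_cont => //; [exact: ucells_closed|exact: ucells_closed|].
    exact: cont_on_sub alc.
  - rewrite ucellsU; apply: (@cont_on_sub _ _ _ ((I01 `*` ucells S12) `|` (I01 `*` ucells BW))).
      by move=> w [? [?|?]]; [left|right].
    by apply: paste_cont => //; apply: closed_setX; [exact: I01_closed|exact: ucells_closed|
      exact: I01_closed|exact: ucells_closed].
  - exact: SP.
  - rewrite ucellsU => t z It [z1|z1].
      by rewrite pasteL//; apply: VW; exact: H12V.
    by rewrite (pasteR hov)//; apply: SP; exact: BWS.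
  - rewrite ucellsU => z [z1|z1]; first by rewrite !pasteL ?H120.
    by rewrite (pasteR hov)// (pasteR aov)//= fal//; exact: BWB.
  - rewrite ucellsU => z [z1|z1]; first by rewrite pasteL ?H121.
    by rewrite (pasteR hov).
  have inU (z : 'rV[R]_n) : ucells S12 z -> ucells (S12 :|: BW) z by rewrite ucellsU; left.
  have inB (z : 'rV[R]_n) : ucells (S W) z -> ucells B z -> ucells BW z.
    by move=> z1 z2; exact: ucellsI.
  have inU' (z : 'rV[R]_n) : ucells BW z -> ucells (S12 :|: BW) z by rewrite ucellsU; right.
  exists a1, H1; split=> //.
  - split=> [z Sz|t z It Sz]; first by rewrite a1S ?pasteL//; exact: inU.
    by rewrite H1S ?pasteL//; exact: inU.
  - split=> [z z1 z2|t z It z1 z2]; have z3 := inB _ z1 z2.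
      by rewrite a1S ?(pasteR aov)//; exact: inU'.
    by rewrite H1S ?(pasteR hov)//; exact: inU'.
  - by move=> z Sz; rewrite H10// H11.
have [||a1 [H1 [[a1c H1c] [a1S H1S] [a1B H1B] H101 H1V]]] := step V1 l1.
- exact: finset.subsetIl.
- by move=> u [].
have [||a2 [H2 [[a2c H2c] [a2S H2S] [a2B H2B] H201 H2V]]] := step V2 l2.
- exact: finset.subsetIr.
- by move=> u [].
have aov z : ucells (S V1) z -> ucells (S V2) z -> a1 z = a2 z.
  by move=> z1 z2; rewrite a1S ?a2S//; exact: ucellsI.
have hov w : (I01 `*` ucells (S V1)) w -> (I01 `*` ucells (S V2)) w -> H1 w = H2 w.
  by case: w => t z [/= It z1] [_ /= z2]; rewrite H1S ?H2S//; exact: ucellsI.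
pose ga := paste (ucells (S V1)) a1 a2; pose gh := paste (I01 `*` ucells (S V1)) H1 H2.
have ghE t z : I01 t -> box N z ->
    [/\ (V1 `|` V2) (gh (t, z)), ucells B z -> gh (t, z) = be z,
        t = 0 -> gh (t, z) = f (ga z) & t = 1 -> gh (t, z) = be z].
  move=> It /Sall[z1|z1].
    rewrite /gh /ga !pasteL//; split=> [|Bz|t0|t0].
    - by left; exact: H1V.
    - exact: H1B.
    - by rewrite t0; case: (H101 _ z1).
    - by rewrite t0; case: (H101 _ z1).
  rewrite /gh /ga (pasteR hov)// (pasteR aov)//; split=> [|Bz|t0|t0].
  - by right; exact: H2V.
  - exact: H2B.
  - by rewrite t0; case: (H201 _ z1).
  - by rewrite t0; case: (H201 _ z1).
exists (fun x => ga (usc x)); split.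
- apply: (cont_on_comp (paste_cont aov _ _ a1c a2c)); [exact: ucells_closed|exact: ucells_closed|exact: uscc|].
  by move=> x dx; apply: Sall; exact: uscD.
- move=> x sx; have Bx := SB _ sx; rewrite -[x in RHS]scK -/(al (usc x)) /ga.
  have [z1|z1] := Sall _ (uscD _ (sphere_disc sx)); first by rewrite pasteL ?a1B.
  by rewrite (pasteR aov)// a2B.
exists (fun w => gh (w.1, usc w.2)); split.
- have ghc : cont_on (I01 `*` ucells (S V1) `|` I01 `*` ucells (S V2)) gh.
    by apply: paste_cont => //; apply: closed_setX; [exact: I01_closed|exact: ucells_closed|
      exact: I01_closed|exact: ucells_closed].
  apply: (cont_on_comp ghc).
    by cont; apply: (cont_on_comp (uscc setT)); [cont|].
  by move=> [t x] [/= It dx]; have [z1|z1] := Sall _ (uscD _ dx); [left|right].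
- by move=> x dx /=; have [_ _ /(_ erefl) -> _] := ghE 0 _ I0 (uscD _ dx).
- move=> x dx /=; have [_ _ _ /(_ erefl) ->] := ghE 1 _ I1 (uscD _ dx).
  by rewrite /be scK.
- move=> t x It sx /=.
  have [_ /(_ (SB _ sx)) -> _ _] := ghE _ _ It (uscD _ (sphere_disc sx)).
  by rewrite /be scK.
- by move=> t x It dx /=; have [] := ghE _ _ It (uscD _ dx).
Qed.

End OpenUnion.

(** * Finite spaces and homotopies on quotients *)

Lemma downtop_open (T : choiceType) (le : rel T) (A : set (downtop le)) :
  down_open A -> open A.
Proof. by []. Qed.

(** Open sets are down-sets, so the elements below a point lie in all its neighbourhoods. *)
Lemma cont_on_downtop (Z : topologicalType) (A : set Z) (T : choiceType)
    (le : rel T) (g : Z -> downtop le) :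
  (forall z, A z -> \forall y \near z, A y -> le (g y) (g z)) -> cont_on A g.
Proof.
move=> gle z Az O; rewrite nbhsE => -[B [oB Bz] BO].
have := gle z Az; apply: filterS => y yz Ay; apply: BO.
by apply: (oB _ _ _ Bz); exact: yz.
Qed.

Lemma downtop_near (Z : topologicalType) (A : set Z) (T : choiceType)
    (le : rel T) (g : Z -> downtop le) : reflexive le -> transitive le ->
  cont_on A g -> forall z, A z -> \forall y \near z, A y -> le (g y) (g z).
Proof.
move=> ler let_ /cont_onP gc z Az; apply: (gc z Az [set w : downtop le | le w (g z)]).
apply: open_nbhs_nbhs; split; last exact: ler.
by move=> x y yx xz; exact: let_ xz.
Qed.

(* Whitehead's argument: the product of a quotient map with the compact unit
   interval is again a quotient map. *)
Lemma cont_on_quotient_homotopy (R : realType) (Y Z W : topologicalType)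
    (pi : Y -> Z) (A : set Z) (g : R * Z -> W) :
  (forall z, exists y, pi y = z) ->
  (forall B : set Z, open (pi @^-1` B) -> open B) -> open (pi @^-1` A) ->
  cont_on (I01 `*` (pi @^-1` A)) (fun w => g (w.1, pi w.2)) ->
  cont_on (I01 `*` A) g.
Proof.
move=> pi_surj pi_open oA /cont_onP gc; apply/cont_onP => -[t0 z0] [/= It0 Az0] O.
rewrite nbhsE => -[Q [oQ Qz] QO]; have [y0 y0z] := pi_surj z0.
have gO (t : R) y : I01 t -> A (pi y) -> Q (g (t, pi y)) ->
    \forall w \near (t, y), (I01 `*` (pi @^-1` A)) w -> Q (g (w.1, pi w.2)).
  by move=> It Ay gty; apply: (gc (t, y)) => //; exact: open_nbhs_nbhs.
have : \forall w \near (t0, y0), (I01 `*` (pi @^-1` A)) w -> Q (g (w.1, pi w.2)).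
  by apply: gO; rewrite ?y0z.
move=> [[J0 G0] [/= nJ0 nG0] JG0].
have /nbhs_ballP[e /= e0 eJ] := nJ0.
pose J : set R := I01 `&` [set t | `|t0 - t| <= e / 2].
have Jc : compact J.
  rewrite (_ : J = `[0, 1]%classic `&` [set t | `|t0 - t| <= e / 2]).
    apply: compact_closedI; first exact: segment_compact.
    apply: (@closed_comp _ _ (fun t : R => `|t0 - t|) [set r : R | r <= e / 2]) => [t _|].
      by move: t; apply: cont_on_continuous; cont.
    exact: closed_le.
  by congr (_ `&` _); apply/seteqP; split=> x /=; rewrite in_itv.
(* [G] lives downstairs, so its preimage in [Y] is saturated by construction. That preimage is open
   because the condition is imposed over the compact [J] only. *)
pose G : set Z := A `&` [set z | forall t, J t -> Q (g (t, z))].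
have Gz0 : G z0.
  split=> // t [It /= te]; rewrite -y0z; apply: (JG0 (t, y0)).
    split=> /=; last exact: nbhs_singleton nG0.
    by apply: eJ; rewrite -ball_normE /ball_ /=; lra.
  by split=> //=; rewrite y0z.
have oG : open G.
  apply: pi_open; rewrite openE => y [Ay Gy].
  have /compact_near_coveringP/(_ Y (nbhs y)
    (fun y' t => I01 t -> A (pi y') -> Q (g (t, pi y')))) := Jc.
  move=> cov; have nA : nbhs y (pi @^-1` A) by exact: open_nbhs_nbhs.
  have nG : \forall y' \near y, J `<=` (fun t => I01 t -> A (pi y') -> Q (g (t, pi y'))).
    apply: cov => t Jt; have [It _] := Jt.
    have := gO t y It Ay (Gy t Jt); apply: filterS => -[t' y'] h It' Ay'.
    exact: h.
  apply: filterS2 nA nG => y' Ay' hy'; split=> //= t Jt.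
  by apply: (hy' t Jt) => //; case: Jt.
have e20 : 0 < e / 2 by lra.
exists (ball t0 (e / 2), G).
  by split; [exact: nbhsx_ballx|exact: open_nbhs_nbhs].
move=> [t z] [/= te [Az Gz]] [/= It _]; apply: QO; apply: Gz; split=> //=.
by move: te; rewrite -ball_normE /ball_ /= => /ltW.
Qed.

Lemma cont_on_sigT (R W : topologicalType) (I : choiceType) (X : I -> topologicalType)
    (A : set (R * {i & X i})) (g : R * {i & X i} -> W) :
  (forall i, cont_on [set w : R * X i | A (w.1, existT X i w.2)]
     (fun w => g (w.1, existT X i w.2))) -> cont_on A g.
Proof.
move=> gc; apply/cont_onP => -[t [i x]] Atx O gO.
have /cont_onP/(_ (t, x) Atx O gO) [[B C] [/= nB nC] BC] := gc i.
exists (B, existT X i @` C); first by split=> //; exact: existT_nbhs.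
by move=> [t' u] [/= Bt' [x' Cx' <-]] Atx'; exact: (BC (t', x') (conj Bt' Cx') Atx').
Qed.

(** * The comparison map *)

(** Abstracts the boolean of the dependent [if] in [groth_le], where [erefl] blocks a direct case
    analysis. *)
Lemma groth_if (b : bool) (F : b = true -> bool) :
  (if b as b' return (b = b' -> bool) then fun h => F h else fun=> false) erefl <->
  exists h, F h.
Proof.
case: b F => F; split=> //; [by exists erefl| |by case].
by case=> h; rewrite (eq_irrelevance h erefl).
Qed.

Section Comparison.
Local Open Scope quotient_scope.
Variables (R : realType) (d : Order.disp_t) (P : finPOrderType d).
Variables (dX : Order.disp_t) (K : top_diagram P) (X : poset_diagram P dX).
Variable phi : diagram_morphism K X.

Local Notation pre := (hocolim_pre R K).
Local Notation hoc := (hocolim R K).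
Local Notation nh := (nh_hocolim X).

Lemma groth_leP (u v : groth_carrier X) : groth_le u v <->
  exists h : (tag u <= tag v)%O, (Defs.pmap X h (tagged u) <= tagged v)%O.
Proof. exact: groth_if. Qed.

Lemma groth_le_refl : reflexive (@groth_le d P dX X).
Proof.
move=> u; apply/groth_leP; exists (lexx _); rewrite pmap_id; exact: lexx.
Qed.

Lemma groth_le_trans : transitive (@groth_le d P dX X).
Proof.
move=> v u w /groth_leP[h1 le1] /groth_leP[h2 le2]; apply/groth_leP.
exists (le_trans h1 h2); rewrite -(@pmap_comp _ _ _ X _ _ _ h1 h2).
by apply: le_trans le2; exact: pmap_mono.
Qed.

Definition hpi (u : pre) : hoc :=
  \pi_(quotient_topology {eq_quot (hocolim_equiv R K)}) u.
Definition hrepr (z : hoc) : pre :=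
  @repr _ (quotient_topology {eq_quot (hocolim_equiv R K)}) z.

Lemma hreprK z : hpi (hrepr z) = z.
Proof. exact: reprK. Qed.

Lemma hpi_step u v : hocolim_step u v -> hpi u = hpi v.
Proof.
move=> uv; apply/eqmodP; rewrite /= /hocolim_rel; apply/asboolP; exact: rst_step.
Qed.

(** Maps out of the quotient are defined on chosen representatives; compatibility with generating
    steps makes them computable on any representative. *)
Lemma hocolim_descend (W : Type) (g : pre -> W) :
  (forall u v, hocolim_step u v -> g u = g v) -> forall u, g (hrepr (hpi u)) = g u.
Proof.
move=> gs u.
have gcl x y : clos_refl_sym_trans _ (@hocolim_step R d P K) x y -> g x = g y.
  by elim=> [? ? /gs|//|? ? _ ->|? ? ? _ -> _ ->].
have : hpi (hrepr (hpi u)) = hpi u by exact: hreprK.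
move=> /eqmodP; rewrite /= /hocolim_rel => /asboolP; exact: gcl.
Qed.

Lemma hpi_open (B : set hoc) : open (hpi @^-1` B) -> open B.
Proof. by []. Qed.

Lemma hpi_continuous : continuous hpi.
Proof. exact: pi_continuous. Qed.

Definition is_min (be : P -> R) (m : P) :=
  be m != 0 /\ forall r, be r != 0 -> (m <= r)%O.

Lemma is_min_ex (Q : set P) be : order_complex_point Q be -> exists m, is_min be m.
Proof.
move=> [be0 be1 _ bec].
have [r0 r0P] : exists r, be r != 0.
  apply/existsP; apply: contraT; rewrite negb_exists => /forallP h.
  have : \sum_r be r = 0 by apply: big1 => r _; apply/eqP; rewrite -[_ == _]negbK; exact: h.
  by rewrite be1 => /eqP; rewrite oner_eq0.
(* The support is a nonempty chain, so the vertex with the fewest elements below it is the least. *)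
case: (@arg_minnP _ r0 [pred r | be r != 0] (fun r => #|[pred s | (s <= r)%O]|) r0P).
move=> m /= m0 mmin; exists m; split=> // r r0'.
have /orP[//|rm] := bec m r m0 r0'.
have := mmin r r0'; rewrite leqNgt; apply: contraNT => mr.
apply: proper_card; apply/properP; split.
  by apply/fintype.subsetP => s; rewrite !inE => sr; exact: le_trans rm.
by exists m; rewrite !inE.
Qed.

Lemma is_min_uniq be m m' : is_min be m -> is_min be m' -> m = m'.
Proof. by move=> [m0 mm] [m0' mm']; apply: le_anti; rewrite mm//= mm'. Qed.

Definition bary (u : pre) : P -> R := val (tagged u).2.

Lemma baryP (u : pre) : order_complex_point (upset (tag u)) (bary u).
Proof. exact: set_mem (valP (tagged u).2). Qed.

(** A relation rather than a function, because the fibre [X_m] and the arrow to [m] both depend on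
    the least vertex [m]. *)
Definition phi_spec (u : pre) (v : groth_carrier X) := is_min (bary u) (tag v) /\
  exists h : (tag u <= tag v)%O, tagged v = dmor phi (tag v) (tmap K h (tagged u).1).

Lemma phi_spec_ex u : exists v, phi_spec u v.
Proof.
have [m mm] := is_min_ex (baryP u).
have h : (tag u <= m)%O by have [_ _ + _] := baryP u; apply; case: mm.
by exists (existT _ m (dmor phi m (tmap K h (tagged u).1) : pobj X m)); split=> //; exists h.
Qed.

Lemma phi_spec_uniq u v v' : phi_spec u v -> phi_spec u v' -> v = v'.
Proof.
case: v v' => [m x] [m' x'] [/= mm [h ->]] [/= mm' [h' ->]].
have mE := is_min_uniq mm mm'; rewrite -{}mE in h' x' mm' *.
by rewrite (bool_irrelevance h' h).
Qed.

Lemma phi_spec_step u u' v : hocolim_step u u' -> phi_spec u' v -> phi_spec u v.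
Proof.
move=> [h [ab be]] [mm [h' vE]]; split; first by rewrite /bary be.
by exists (le_trans h h'); rewrite vE -ab (@tmap_comp _ _ K _ _ _ h h' (le_trans h h')).
Qed.

Definition phipre u : nh := projT1 (cid (phi_spec_ex u)).

Lemma phipreP u : phi_spec u (phipre u).
Proof. exact: projT2 (cid (phi_spec_ex u)). Qed.

Definition phihat (z : hoc) : nh := phipre (hrepr z).

Lemma phihat_pi u : phihat (hpi u) = phipre u.
Proof.
apply: (@hocolim_descend _ phipre) => x y xy.
exact: phi_spec_uniq (phipreP x) (phi_spec_step xy (phipreP y)).
Qed.

Lemma bary_continuous (q : P) (r : P) :
  continuous (fun x : tobj K q * realization_F R q => (val x.2 : P -> R) r).
Proof.
apply: cont_on_continuous.
apply: (@cont_on_compT _ {ptws P -> R} R _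
  (fun x : tobj K q * realization_F R q => val x.2) (fun g => g r)).
  exact: ptws_proj_continuous.
by apply: (cont_on_compT (@set_val_continuous _ _)); cont.
Qed.

(** Near a point the coordinate at its least vertex [m0] stays nonzero, so the least vertex [m] of a
    nearby point satisfies [m <= m0]. Naturality carries its value from [X_m] to [X_m0], where
    continuity of [phi] at [m0] puts it below the original value. *)
Lemma phihat_continuous : continuous phihat.
Proof.
apply/quotient_continuous.
rewrite (_ : phihat \o _ = phipre); last by apply/funext => u; exact: phihat_pi.
suff cq q : continuous (fun x : tobj K q * realization_F R q => phipre (existT _ q x)).
  apply/continuousP => O oO; apply/sigT_openP => q.
  by have /continuousP/(_ O oO) := cq q.
apply: cont_on_continuous; apply: cont_on_downtop => x0 _.
have [mm0 [/= h0 v0]] := phipreP (existT _ q x0); set m0 := tag _ in mm0 h0 v0.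
have nbe : \forall x \near x0, (val x.2 : P -> R) m0 != 0.
  have /= := @bary_continuous q m0 x0 [set r | r != 0]; apply.
  by apply: open_nbhs_nbhs; split; [exact: open_neq|case: mm0].
have gc : cont_on setT (fun x : tobj K q * realization_F R q => dmor phi m0 (tmap K h0 x.1)).
  apply: (cont_on_compT (@dmor_cont _ _ _ _ _ phi m0)).
  by apply: (cont_on_compT (@tmap_cont _ _ K _ _ h0)); cont.
have := downtop_near (@le_refl _ _) (@le_trans _ _) gc (I : setT x0).
move=> nle; apply: filterS2 nbe nle => x xm xle _.
have [mm [/= h v]] := phipreP (existT _ q x); set m := tag _ in mm h v.
have hm : (m <= m0)%O by case: mm => _; exact.
apply/groth_leP; exists hm.
by rewrite v0 v -dmor_nat (@tmap_comp _ _ K _ _ _ h hm h0); exact: xle.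
Qed.

End Comparison.

(** * Lifting over the open set below one vertex *)

Section LocalLifting.
Variables (R : realType) (d : Order.disp_t) (P : finPOrderType d).
Variables (dX : Order.disp_t) (K : top_diagram P) (X : poset_diagram P dX).
Variables (phi : diagram_morphism K X) (p : P).

Local Notation pre := (hocolim_pre R K).
Local Notation hoc := (hocolim R K).
Local Notation nh := (nh_hocolim X).
Local Notation phihat := (@phihat R _ _ _ _ _ phi).

Definition below : set nh := [set v | (tag (v : groth_carrier X) <= p)%O].

Definition low (be : P -> R) := exists2 r, (r <= p)%O & be r != 0.

Lemma below_phihat (u : pre) : below (phihat (hpi u)) <-> low (bary u).
Proof.
rewrite phihat_pi; have [[m0 mm] _] := phipreP phi u; split.
  by move=> mp; exists (tag (phipre phi u : groth_carrier X)).
by move=> [r rp r0]; apply: le_trans rp; exact: mm.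
Qed.

Lemma low_tag (u : pre) : low (bary u) -> (tag u <= p)%O.
Proof.
move=> [r rp r0]; apply: le_trans rp; have [_ _ + _] := baryP u; exact.
Qed.

Lemma low_open q : open [set x : tobj K q * realization_F R q | low (val x.2)].
Proof.
rewrite openE => x [r rp r0].
have nb : nbhs ((val x.2 : P -> R) r) [set s | s != 0].
  by apply: open_nbhs_nbhs; split=> //; exact: open_neq.
have nx : \forall y \near x, (val y.2 : P -> R) r != 0.
  exact: (@bary_continuous R _ _ K q r x _ nb).
by apply: filterS nx => y y0; exists r.
Qed.

(* The mass outside the down-set of [p] is removed during [0, 1/2], the
   remaining mass is moved to [p] during [1/2, 1]. *)
Definition push_raw (t : R) (be : P -> R) (r : P) : R :=
  be r * (if (r <= p)%O then Num.min 1 (2 - 2 * t) else Num.max 0 (1 - 2 * t))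
  + (r == p)%:R * Num.max 0 (2 * t - 1).

Definition push (t : R) (be : P -> R) (r : P) : R :=
  (\sum_s push_raw t be s)^-1 * push_raw t be r.

Section Push.
Variables (q : P) (t : R) (be : P -> R).
Hypothesis bep : order_complex_point (upset q) be.
Hypothesis bel : low be.
Hypothesis It : I01 t.

Let be0 r : 0 <= be r. Proof. by case: bep. Qed.

Lemma push_raw_ge0 r : 0 <= push_raw t be r.
Proof.
move: It => /andP[t0 t1].
apply: addr_ge0; apply: mulr_ge0 => //; last by rewrite le_max lexx.
by case: ifP => _; [rewrite le_min ler01 /=; lra|rewrite le_max lexx].
Qed.

(** Normalisation never divides by 0: before time 1 a vertex of the carrier below [p] keeps positive
    weight, and at time 1 the vertex [p] has it. *)
Lemma push_raw_gt0 : exists2 r, (r <= p)%O & 0 < push_raw t be r.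
Proof.
move: It => /andP[t0 t1]; case: bel => r rp r0.
have [t_1|t_1] := eqVneq t 1.
  exists p => //; rewrite /push_raw eqxx lexx t_1 mul1r.
  apply: ltr_wpDl; last by rewrite lt_max; apply/orP; right; lra.
  by apply: mulr_ge0 => //; rewrite le_min ler01 /=; lra.
have t1' : t < 1 by rewrite lt_neqAle t_1.
exists r => //; rewrite /push_raw rp; apply: ltr_wpDr.
  by apply: mulr_ge0 => //; rewrite le_max lexx.
apply: mulr_gt0; first by rewrite lt_neqAle eq_sym r0 be0.
by rewrite lt_min ltr01 /=; lra.
Qed.

Lemma push_sum_gt0 : 0 < \sum_s push_raw t be s.
Proof.
have [r _ r0] := push_raw_gt0; rewrite (bigD1 r)//=; apply: ltr_wpDr => //.
by apply: sumr_ge0 => s _; exact: push_raw_ge0.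
Qed.

Lemma push_neq0 r : (push t be r != 0) = (push_raw t be r != 0).
Proof. by rewrite /push mulf_eq0 invr_eq0 (gt_eqF push_sum_gt0). Qed.

Lemma push_low : low (push t be).
Proof.
have [r rp r0] := push_raw_gt0; exists r => //.
by rewrite push_neq0 gt_eqF.
Qed.

(** The reason for two separate phases: [p] may enter the support only once all vertices not below
    [p] have left it, so the support remains a chain. *)
Lemma push_raw_supp r : push_raw t be r != 0 ->
  [/\ be r != 0 & (r <= p)%O || (2 * t < 1)] \/ (r = p /\ 1 < 2 * t).
Proof.
move=> r0; have [rp|rp] := eqVneq r p.
  have [?|t2] := ltP 1 (2 * t); first by right.
  have t20 : Num.max 0 (2 * t - 1) = 0 by rewrite max_l//; lra.
  left; move: r0; rewrite /push_raw t20 mulr0 addr0.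
  by rewrite mulf_eq0 negb_or => /andP[-> _]; rewrite rp lexx.
left; move: r0; rewrite /push_raw (negbTE rp) mul0r addr0 mulf_eq0 negb_or => /andP[-> ].
case: ifP => // _; have [//|t2] := ltP (2 * t) 1.
by rewrite max_l ?eqxx//; lra.
Qed.

Lemma push_point : order_complex_point (upset q) (push t be).
Proof.
have [_ _ beq bec] := bep.
have qp : (q <= p)%O by case: bel => r rp r0; apply: le_trans rp; exact: beq.
split.
- move=> r; apply: mulr_ge0; last exact: push_raw_ge0.
  by rewrite invr_ge0 ltW// push_sum_gt0.
- by rewrite -mulr_sumr mulVf// gt_eqF// push_sum_gt0.
- move=> r; rewrite push_neq0 => /push_raw_supp[[r0 _]|[-> _]] //; exact: beq.
- move=> r s; rewrite !push_neq0 => /push_raw_supp[[r0 rp]|[-> t2]] /push_raw_supp[[s0 sp]|[-> t2']].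
  + exact: bec.
  + by case/orP: rp => [->//|t3]; have := lt_trans t2' t3; rewrite ltxx.
  + by case/orP: sp => [->|t3]; [rewrite orbT|have := lt_trans t2 t3; rewrite ltxx].
  + by rewrite lexx.
Qed.

End Push.

Lemma push0 q be : order_complex_point (upset q) be -> push 0 be = be.
Proof.
move=> [_ be1 _ _].
have raw0 r : push_raw 0 be r = be r.
  rewrite /push_raw mulr0 !subr0 sub0r (@max_l _ _ 0 (-1)) ?lerN10//.
  by rewrite max_r// min_l ?ler1n// mulr0 addr0; case: ifP => _; rewrite mulr1.
by apply/funext => r; rewrite /push raw0 (eq_bigr _ (fun s _ => raw0 s)) be1 invr1 mul1r.
Qed.

Lemma push1 be : push 1 be = fun r => (r == p)%:R.
Proof.
have raw1 r : push_raw 1 be r = (r == p)%:R.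
  have -> : push_raw 1 be r = be r * (if (r <= p)%O then Num.min 1 0 else Num.max 0 (-1))
      + (r == p)%:R * Num.max 0 1.
    by rewrite /push_raw; do ![congr (_ * _)|congr (_ + _)|congr (if _ then _ else _)|
      congr (Num.min _ _)|congr (Num.max _ _)]; lra.
  rewrite min_r// max_l ?lerN10// max_r// mulr1.
  by case: ifP => _; rewrite mulr0 add0r.
apply/funext => r; rewrite /push raw1 (eq_bigr _ (fun s _ => raw1 s)).
rewrite (bigD1 p)//= eqxx big1 ?addr0 ?invr1 ?mul1r// => s /negbTE ->.
by [].
Qed.

Lemma vertex_point : order_complex_point (upset p) (fun r => (r == p)%:R : R).
Proof.
split=> [r||r|r s]; first exact: ler0n.
- by rewrite (bigD1 p)//= eqxx big1 ?addr0// => s /negbTE ->.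
- by case: (eqVneq r p) => [-> _|]; rewrite ?eqxx// /upset /=.
- case: (eqVneq r p) => [->|]; last by rewrite eqxx.
  by case: (eqVneq s p) => [->|]; rewrite ?lexx// eqxx.
Qed.

Definition vertex : realization_F R p := SigSub (mem_set vertex_point).

(** The default [be] makes the map total. The case distinction depends only on the coordinates and
    on [t], so it respects the gluing relation. *)
Definition push_real q (t : R) (be : realization_F R q) : realization_F R q :=
  match pselect (low (val be) /\ I01 t) with
  | left c => SigSub (mem_set (push_point (set_mem (valP be)) c.1 c.2))
  | right _ => be
  end.

Lemma val_push_real q t (be : realization_F R q) : low (val be) -> I01 t ->
  val (push_real t be) = push t (val be) :> (P -> R).
Proof. by rewrite /push_real => bl It; case: pselect => // -[]; split. Qed.

Definition push_hoc (t : R) (u : pre) : hoc :=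
  hpi (existT _ (tag u) ((tagged u).1, push_real t (tagged u).2)).

Definition retr_hoc (w : R * hoc) : hoc := push_hoc w.1 (hrepr w.2).

Lemma retr_hoc_pi t u : retr_hoc (t, hpi u) = push_hoc t u.
Proof.
apply: (@hocolim_descend R d P K _ (push_hoc t)) => x y [h [xy be]].
apply: hpi_step; exists h; split=> //.
change (val (push_real t (tagged x).2) = val (push_real t (tagged y).2) :> (P -> R)).
have [[l It]|n] := pselect (low (val (tagged x).2) /\ I01 t).
  by rewrite !val_push_real ?be// -be.
rewrite /push_real; case: pselect => // _; case: pselect => // -[l It].
by case: n; split=> //; rewrite be.
Qed.

Lemma push_real_cont q : cont_on
  [set w : R * (tobj K q * realization_F R q) | I01 w.1 /\ low (val w.2.2)]
  (fun w => push_real w.1 w.2.2).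
Proof.
apply: cont_on_set_type.
apply: (@cont_on_eq _ {ptws P -> R} _
  (fun w : R * (tobj K q * realization_F R q) => push w.1 (val w.2.2))).
  by move=> w [Iw lw]; rewrite val_push_real.
apply: cont_on_ptws => r.
have bc s (A : set (R * (tobj K q * realization_F R q))) :
    cont_on A (fun w => (val w.2.2 : P -> R) s).
  by apply: (cont_on_compT (@bary_continuous R d P K q s)); cont.
have rawc s (A : set (R * (tobj K q * realization_F R q))) :
    cont_on A (fun w => push_raw w.1 (val w.2.2) s).
  rewrite /push_raw; apply: cont_onD; last by cont.
  by apply: cont_onM; [exact: bc|case: (s <= p)%O; cont].
apply: cont_onM; last exact: rawc.
apply: cont_onV; last by apply: cont_on_sum => s; exact: rawc.
move=> [t [k be]] [/= It bl]; rewrite gt_eqF//.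
exact: (push_sum_gt0 (set_mem (valP be))).
Qed.

Lemma hpi_existT_continuous q :
  continuous (fun x : tobj K q * realization_F R q => hpi (existT _ q x)).
Proof.
apply: cont_on_continuous.
apply: (@cont_on_compT _ _ _ _ (fun x : tobj K q * realization_F R q => existT _ q x : pre)).
  exact: hpi_continuous.
by apply: continuous_cont_on; exact: existT_continuous.
Qed.

Lemma hpi_surj (z : hoc) : exists u, hpi u = z.
Proof. by exists (hrepr z); exact: hreprK. Qed.

Lemma low_pre_open : open (@hpi R d P K @^-1` (phihat @^-1` below)).
Proof.
rewrite (_ : _ @^-1` _ = [set u : pre | low (bary u)]); last first.
  by apply/seteqP; split=> u /below_phihat.
apply/sigT_openP => q; exact: low_open.
Qed.

Lemma retr_hoc_cont : cont_on (I01 `*` (phihat @^-1` below)) retr_hoc.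
Proof.
apply: (@cont_on_quotient_homotopy _ _ _ _ (@hpi R d P K)).
- exact: hpi_surj.
- exact: hpi_open.
- exact: low_pre_open.
apply: (@cont_on_eq _ _ _ (fun w => push_hoc w.1 w.2)).
  by move=> w _; rewrite retr_hoc_pi.
apply: cont_on_sigT => q.
apply: (@cont_on_eq _ _ _ (fun w : R * (tobj K q * realization_F R q) =>
  hpi (existT _ q (w.2.1, push_real w.1 w.2.2)))) => //.
apply: (cont_on_compT (@hpi_existT_continuous q)); apply: cont_on_pair; first by cont.
by apply: cont_on_sub (@push_real_cont q) => -[t x] [/= It /below_phihat].
Qed.

Lemma retr_hoc0 z : (phihat @^-1` below) z -> retr_hoc (0, z) = z.
Proof.
have [[q [k be]] <-] := hpi_surj z; move=> /below_phihat lw.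
rewrite retr_hoc_pi /push_hoc /=; congr (hpi (existT _ q (k, _))).
apply: val_inj; rewrite val_push_real//; last by rewrite /I01 /= lexx ler01.
exact: (push0 (set_mem (valP be))).
Qed.

Lemma retr_hoc_below t z : I01 t -> (phihat @^-1` below) z ->
  (phihat @^-1` below) (retr_hoc (t, z)).
Proof.
move=> It; have [[q [k be]] <-] := hpi_surj z; move=> /below_phihat lw.
rewrite retr_hoc_pi; apply/below_phihat; rewrite /bary /= val_push_real//.
exact: (push_low (set_mem (valP be))).
Qed.

Definition incl (k : tobj K p) : hoc := hpi (existT _ p (k, vertex)).

Lemma incl_continuous : continuous incl.
Proof.
apply: cont_on_continuous; apply: (cont_on_compT (@hpi_existT_continuous p)).
by cont.
Qed.

Definition incl_nh (x : pobj X p) : nh := existT _ p x : groth_carrier X.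

Lemma phihat_incl k : phihat (incl k) = incl_nh (dmor phi p k).
Proof.
rewrite phihat_pi; apply: phi_spec_uniq (phipreP phi _) _; split=> /=.
  split=> [|r]; rewrite /bary /= ?eqxx ?oner_eq0//.
  by case: (eqVneq r p) => [->//|]; rewrite eqxx.
by exists (lexx p); rewrite tmap_id.
Qed.

Section Retractions.
Variable k0 : tobj K p.

(** The transition map into [K_p] exists where the carrier meets the down-set of [p]; [k0] is the
    value elsewhere. *)
Definition retr_pre (u : pre) : tobj K p :=
  match pselect (low (bary u)) with
  | left l => tmap K (low_tag l) (tagged u).1
  | right _ => k0
  end.

Lemma retr_preE (u : pre) (h : (tag u <= p)%O) : low (bary u) ->
  retr_pre u = tmap K h (tagged u).1.
Proof.
by rewrite /retr_pre; case: pselect => // l _; rewrite (bool_irrelevance (low_tag l) h).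
Qed.

Definition retr (z : hoc) : tobj K p := retr_pre (hrepr z).

Lemma retr_pi u : retr (hpi u) = retr_pre u.
Proof.
apply: (@hocolim_descend R d P K _ retr_pre) => x y [h [xy be]].
have bxy : bary x = bary y by [].
have [l|l] := pselect (low (bary x)).
  have l' : low (bary y) by rewrite -bxy.
  rewrite (retr_preE (low_tag l) l) (retr_preE (low_tag l') l') -xy.
  by rewrite (@tmap_comp _ _ K _ _ _ h (low_tag l') (low_tag l)).
rewrite /retr_pre; case: pselect => // _; case: pselect => // l'.
by case: l; rewrite bxy.
Qed.

Lemma retr_cont : cont_on (phihat @^-1` below) retr.
Proof.
apply/cont_onP => z bz O; rewrite nbhsE => -[B [oB Bz] BO].
suff oG : open ((phihat @^-1` below) `&` (retr @^-1` B)).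
  have : nbhs z ((phihat @^-1` below) `&` (retr @^-1` B)) by exact: open_nbhs_nbhs.
  by apply: filterS => y [_ By] _; exact: BO.
apply: hpi_open; apply/sigT_openP => q.
have [qp|qp] := boolP (q <= p)%O; last first.
  rewrite (_ : _ @^-1` _ = set0); first exact: open0.
  by apply/seteqP; split=> // x [/below_phihat/low_tag /= h]; rewrite h in qp.
rewrite (_ : _ @^-1` _ = [set x | low (val x.2)] `&`
    ((fun x : tobj K q * realization_F R q => tmap K qp x.1) @^-1` B)).
  apply: openI; first exact: low_open.
  apply: open_comp => // x _; move: x; apply: cont_on_continuous.
  by apply: (cont_on_compT (@tmap_cont _ _ K _ _ qp)); cont.
apply/seteqP; split=> x.
  move=> [/below_phihat l]; rewrite /preimage /= retr_pi.
  by rewrite (@retr_preE (existT _ q x) qp).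
move=> [l] /=; split; first exact/below_phihat.
by rewrite /preimage /= retr_pi (@retr_preE (existT _ q x) qp).
Qed.

(** At time 1 all mass sits at [p], a point of the smaller complex over [p], so the gluing relation
    moves the pair into the summand of [p]. *)
Lemma retr_hoc1 z : (phihat @^-1` below) z -> retr_hoc (1, z) = incl (retr z).
Proof.
have [u <-] := hpi_surj z; move=> /below_phihat lw.
rewrite retr_hoc_pi retr_pi (retr_preE (low_tag lw))//.
apply: hpi_step; exists (low_tag lw); split=> //=.
rewrite val_push_real//; last by rewrite /I01 /= lexx ler01.
exact: push1.
Qed.

Variable x0 : pobj X p.

Definition retr_nh (v : nh) : finspace (pobj X p) :=
  match pselect (tag (v : groth_carrier X) <= p)%O with
  | left h => Defs.pmap X h (tagged (v : groth_carrier X))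
  | right _ => x0
  end.

Lemma retr_nhE (v : nh) (h : (tag (v : groth_carrier X) <= p)%O) :
  retr_nh v = Defs.pmap X h (tagged (v : groth_carrier X)).
Proof. by rewrite /retr_nh; case: pselect => // h'; rewrite (bool_irrelevance h' h). Qed.

Lemma retr_nh_mono (v w : nh) : groth_le v w -> below w ->
  (retr_nh v <= retr_nh w :> pobj X p)%O.
Proof.
move=> /groth_leP[h vw] wp; rewrite (retr_nhE wp) (retr_nhE (le_trans h wp)).
rewrite -(@pmap_comp _ _ _ X _ _ _ h wp); exact: pmap_mono.
Qed.

Lemma retr_nh_incl x : retr_nh (incl_nh x) = x.
Proof. by rewrite (@retr_nhE (incl_nh x) (lexx p)) pmap_id. Qed.

(** Comparable maps into a finite space are homotopic; this inequality is the deformation of the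
    target onto [X_p]. *)
Lemma le_incl_retr v : below v -> groth_le v (incl_nh (retr_nh v)).
Proof. by move=> vp; apply/groth_leP; exists vp; rewrite -(retr_nhE vp). Qed.

Lemma incl_nh_mono x y : (x <= y)%O -> groth_le (incl_nh x) (incl_nh y).
Proof. by move=> xy; apply/groth_leP; exists (lexx p); rewrite pmap_id. Qed.

Lemma incl_nh_continuous : continuous (incl_nh : finspace (pobj X p) -> nh).
Proof.
apply: cont_on_continuous; apply: cont_on_downtop => x _.
have := downtop_near (@le_refl _ _) (@le_trans _ _)
  (@cont_on_id (finspace (pobj X p)) setT) (I : setT x).
by apply: filterS => y yx yT; apply: incl_nh_mono; exact: yx.
Qed.

Lemma retr_nh_cont : cont_on below retr_nh.
Proof.
apply: cont_on_downtop => v bv.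
have := downtop_near (@groth_le_refl _ _ _ X) (@groth_le_trans _ _ _ X)
  (@cont_on_id nh below) bv.
by apply: filterS => w wv bw; apply: retr_nh_mono => //; exact: wv.
Qed.

End Retractions.

Hypothesis phi_weq : weak_homotopy_equivalence R (dmor phi p).

(** The boundary datum is first deformed into the image of [incl]. There [phihat] takes values fixed
    by [incl_nh \o retr_nh], so the homotopy from the retracted [b1] back to [b1] can be stationary
    on the sphere. *)
Lemma lifting_below : lifting_property R phihat below.
Proof.
have [inhK solK] := whe_lifting phi_weq.
have fc := @phihat_continuous R _ _ _ _ _ phi.
split=> [u bu|n a b pb].
  have [k] := inhK (Defs.pmap X bu (tagged (u : groth_carrier X))) I.
  by constructor; exact: incl k.
have [ac bc bV fab] := pb.
have d0 : disc (0 : 'rV[R]_n) by rewrite /disc /= normr0.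
have [k0] := inhK (Defs.pmap X (bV 0 d0) (tagged (b 0 : groth_carrier X))) I.
pose x0 : pobj X p := dmor phi p k0.
have aT x : sphere x -> (phihat @^-1` below) (a x).
  by move=> sx; rewrite /preimage /= fab//; apply/bV/sphere_disc.
apply: (@lift_deform _ _ _ _ _ below (fun w => retr_hoc (w.1, a w.2)) a
  (fun x => incl (retr k0 (a x)))) => //.
- apply: (cont_on_comp retr_hoc_cont).
    by cont; apply: (cont_on_comp ac); [cont|move=> [t x] []].
  by move=> [t x] [/= It sx]; split=> //=; exact: aT.
- by move=> t x It sx /=; apply: retr_hoc_below => //; exact: aT.
- by move=> x sx /=; apply: retr_hoc0; exact: aT.
- by move=> x sx /=; apply: retr_hoc1; exact: aT.
move=> b1 [_ b1c b1V b1s].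
have rb1s x : sphere x -> incl_nh (retr_nh x0 (b1 x)) = b1 x.
  by move=> sx; rewrite -b1s// phihat_incl retr_nh_incl.
have rb1c : cont_on (@disc R n) (fun x => retr_nh x0 (b1 x)).
  exact: (cont_on_comp (@retr_nh_cont x0)).
have [|c [cc cs [G [Gc G0 G1 Gs _]]]] :=
    solK n (fun x => retr k0 (a x)) (fun x => retr_nh x0 (b1 x)).
  split=> //.
  - by apply: (cont_on_comp (@retr_cont k0)).
  - by move=> x sx; rewrite -b1s// phihat_incl retr_nh_incl.
exists (fun x => incl (c x)); split.
- exact: (cont_on_compT incl_continuous).
- by move=> x sx; rewrite cs.
apply: (@rel_homotopic_trans _ _ _ _ _ (fun x => incl_nh (retr_nh x0 (b1 x)))).
  exists (fun w => incl_nh (G w)); split.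
  - exact: (cont_on_compT incl_nh_continuous).
  - by move=> x dx; rewrite G0//= phihat_incl.
  - by move=> x dx; rewrite G1.
  - by move=> t x It sx; rewrite Gs.
  - by move=> t x _ _; rewrite /below /=.
(* The jump at time 0 is continuous: the value at time 0 is the larger one, and continuity only asks
   that nearby values lie below it. *)
exists (fun w => if w.1 <= 0 then incl_nh (retr_nh x0 (b1 w.2)) else b1 w.2); split.
- have b1c2 : cont_on (I01 `*` @disc R n) (fun w : R * 'rV[R]_n => b1 w.2).
    by apply: (cont_on_comp b1c); [cont|move=> [t x] []].
  have b1n := downtop_near (@groth_le_refl _ _ _ X) (@groth_le_trans _ _ _ X) b1c2.
  apply: cont_on_downtop => -[t x] Atx; have [It dx] := Atx; have := b1n _ Atx.
  case: (leP t 0) => /= t0.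
    apply: filterS => -[s y] yx Asy; have [Is dy] := Asy.
    have {}yx := yx Asy; case: ifP => _ /=.
      by apply: incl_nh_mono; apply: retr_nh_mono => //; exact: b1V.
    by apply: groth_le_trans yx _; apply: le_incl_retr; exact: b1V.
  have nt : \forall w \near (t, x), 0 < w.1.
    have /= := @cvg_fst R 'rV[R]_n (nbhs t) (nbhs x) _ [set s | 0 < s].
    by apply; exact: lt_nbhsr.
  by apply: filterS2 nt => -[s y] /= s0 yx Asy; rewrite leNgt s0 /=; exact: yx.
- by move=> x dx /=; rewrite lexx.
- by move=> x dx /=; rewrite ler10.
- by move=> t x It sx /=; case: ifP => _; rewrite ?rb1s.
- move=> t x It dx /=; case: ifP => _; last exact: b1V.
  by rewrite /below /=.
Qed.

End LocalLifting.

(** * Induction over the down-sets of the index poset *)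

Theorem theorem3p1 (R : realType) (d : Order.disp_t) (P : finPOrderType d)
  (dX : Order.disp_t) (K : top_diagram P) (X : poset_diagram P dX)
  (phi : diagram_morphism K X)
  (phi_weq : forall p : P, weak_homotopy_equivalence R (dmor phi p)) :
  exists phihat : hocolim R K -> nh_hocolim X,
    weak_homotopy_equivalence R phihat.
Proof.
exists (phihat phi); apply: lifting_whe; first exact: phihat_continuous.
pose over (D : {set P}) : set (nh_hocolim X) :=
  [set v | tag (v : groth_carrier X) \in D].
pose downcl (D : {set P}) := forall r s, (s <= r)%O -> r \in D -> s \in D.
have over_open D : downcl D -> open (over D).
  by move=> dD; apply: downtop_open => v w /groth_leP[h _] /=; exact: dD.
suff main : forall D : {set P}, downcl D -> lifting_property R (@phihat R _ _ _ _ _ phi) (over D).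
  rewrite (_ : setT = over [set: P]%SET); first by apply: main => r s _ _; rewrite inE.
  by apply/seteqP; split=> v // _; rewrite /over /= inE.
move=> D; have [k] := ubnP #|D|; elim: k D => // k IH D leD dD.
have [->|[p0 p0D]] := set_0Vmem D.
  (* Over the empty set there is no lifting problem, since the disc contains 0. *)
  split=> [u|n a b [_ _ bV _]]; first by rewrite /over /= inE.
  by have := bV 0; rewrite /over /disc /= normr0 inE => /(_ ler01).
(* An element with the most elements below it is maximal in [D], so removing it leaves a down-set
   [D']; the overlap of [over D'] with [below p] lies over the down-set [E]. *)
case: (@arg_maxnP _ p0 (mem D) (fun r => #|[pred s | (s <= r)%O]|) p0D) => p /= pD pmax.
pose D' := D :\ p; pose E := [set r : P in D' | (r <= p)%O]%SET.
have dD' : downcl D'.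
  move=> r s sr; rewrite !inE => /andP[rp rD]; rewrite (dD r)// andbT.
  apply: contraNneq rp => sp; apply/eqP/le_anti; rewrite -{2}sp sr andbT.
  have := pmax r rD; rewrite leqNgt; apply: contraNT => nrp.
  apply: proper_card; apply/properP; split.
    by apply/fintype.subsetP => x; rewrite !inE -sp => xs; exact: le_trans sr.
  by exists r; rewrite !inE.
have dE : downcl E.
  move=> r s sr; rewrite [r \in _]inE => /andP[rD rp].
  by rewrite inE (dD' r)//= (le_trans sr).
have D'D : (#|D'| < #|D|)%N by rewrite [X in (_ < X)%N](cardsD1 p) pD.
have ED' : (#|E| <= #|D'|)%N by apply: subset_leq_card; apply/fintype.subsetP => r; rewrite inE => /andP[].
have -> : over D = over D' `|` below p.
  apply/seteqP; split=> v; rewrite /over /below /=.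
    by move=> vD; have [->|vp] := eqVneq (tag v) p; [right|left; rewrite !inE vp].
  by case=> [|vp]; [rewrite !inE => /andP[]|exact: dD vp _].
apply: lifting_setU.
- exact: over_open.
- by apply: downtop_open => v w /groth_leP[h _] /= vp; exact: le_trans vp.
- by apply: IH => //; exact: leq_trans D'D _.
- exact: lifting_below.
- rewrite (_ : _ `&` _ = over E); last first.
    apply/seteqP; split=> v; rewrite /over /below /=.
      by move=> [vD vp]; rewrite inE vD.
    by rewrite inE => /andP[].
  by apply: IH => //; apply: leq_trans (leq_trans _ D'D) leD.
Qed.
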